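(* Let $K$ be a field of characteristic zero, let $G$ be a finite abelian group, let $\varepsilon$ be an antisymmetric bi-character of $G$ with values in $K^\times$, and let $L$ be a finite-dimensional $G$-graded $\varepsilon$-Lie algebra over $K$. Then: (1) If $L^c$ is a cocycle twist of $L$ (with respect to some triple $(c,\phi,\varepsilon')$), then $\mathcal{U}(L^c)$ is an FCR-algebra if and only if $\mathcal{U}(L)$ is an FCR-algebra. (2) $\mathcal{U}(L)$ is an FCR-algebra if and only if the augmented enveloping algebra $\widetilde{\mathcal{U}}(L)$ is an FCR-algebra.
   Context: All algebras are associative unital $K$-algebras unless they are color Lie algebras; $K^\times=K\setminus\{0\}$. FCR-algebra: an associative $K$-algebra $A$ such that every finite-dimensional representation of $A$ is completely reducible and the intersection of the annihilators of all finite-dimensional representations of $A$ is zero. Antisymmetric bi-character of an abelian group $G$: a map $\varepsilon:G\times G\to K^\times$ with $\varepsilon(g,h)\varepsilon(h,g)=1$, $\varepsilon(g,hk)=\varepsilon(g,h)\varepsilon(g,k)$, $\varepsilon(gh,k)=\varepsilon(g,k)\varepsilon(h,k)$ for all $g,h,k\in G$. $G$-graded $\varepsilon$-Lie algebra (color Lie algebra): a graded $K$-space $L=\oplus_{g\in G}L_g$ with a bilinear map $\langle-,-\rangle:L\times L\to L$ such that $\langle L_g,L_h\rangle\subseteq L_{gh}$; $\langle x,y\rangle=-\varepsilon(g,h)\langle y,x\rangle$; and $\varepsilon(k,g)\langle x,\langle y,z\rangle\rangle+\varepsilon(g,h)\langle y,\langle z,x\rangle\rangle+\varepsilon(h,k)\langle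 z,\langle x,y\rangle\rangle=0$ for all $x\in L_g$, $y\in L_h$, $z\in L_k$, $g,h,k\in G$. For homogeneous $x\in L_g$ write $|x|=g$. Universal enveloping algebra: $\mathcal{U}(L)=\mathcal{T}(L)/\mathcal{J}(L)$, where $\mathcal{T}(L)$ is the tensor algebra and $\mathcal{J}(L)$ is the two-sided ideal generated by $x\otimes y-\varepsilon(g,h)y\otimes x-\langle x,y\rangle$ for $x\in L_g$, $y\in L_h$, $g,h\in G$. It is a $G$-graded algebra. Augmented enveloping algebra: $\widetilde{\mathcal{U}}(L)=KG\otimes\mathcal{U}(L)$ as a vector space ($KG$ the group algebra), with multiplication $(g\otimes x)\cdot(h\otimes y)=\varepsilon(|x|,h)\,gh\otimes xy$ for $g,h\in G$ and homogeneous $x,y\in\mathcal{U}(L)$. Cocycle: a map $c:G\times G\to K^\times$ with $c(g,h)c(gh,k)=c(h,k)c(g,hk)$ for all $g,h,k\in G$. Cocycle twist of $L$: fix a triple $(c,\phi,\varepsilon')$ where $c$ is a cocycle of $G$, $\phi:G\to G'$ is a morphism of abelian groups, and $\varepsilon'$ is an antisymmetric bi-character of $G'$ such that $\varepsilon(g,h)c(g,h)=c(h,g)\varepsilon'(\phi(g),\phi(h))$ for all $g,h\in G$. The cocycle twist $L^c$ of $L$ with respect to this triple is the $G'$-graded $\varepsilon'$-Lie algebra with $L^c=L$ as $K$-space, grading $L^c_{g'}=\oplus_{\phi(g)=g'}L_g$ for $g'\in G'$, and bilinear bracket determined by $\langle x,y\rangle^c=c(g,h)\langle x,y\rangle$ for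 $x\in L_g$, $y\in L_h$, $g,h\in G$. Its enveloping algebra $\mathcal{U}(L^c)$ is formed with respect to $G'$, $\varepsilon'$ and $\langle-,-\rangle^c$. *)

(* Defs.v *)
From HB Require Import structures.
From mathcomp Require Import all_boot all_order all_algebra.
From mathcomp Require Import boolp finmap ring.
From mathcomp.multinomials Require Import monalg.

Set Implicit Arguments.
Unset Strict Implicit.
Unset Printing Implicit Defensive.

Import GRing.Theory.
Local Open Scope ring_scope.
Local Open Scope quotient_scope.

Section FCR.
Variables (K : fieldType) (A : algType K).

Definition representation (V : vectType K) (rho : A -> 'End(V)) : Prop :=
  [/\ linear rho, rho 1 = \1%VF &
      forall a b, rho (a * b) = (rho a \o rho b)%VF].

Section Submodules.
Variables (V : vectType K) (rho : A -> 'End(V)).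

Definition invariant (W : {vspace V}) : Prop := forall a, (rho a @: W <= W)%VS.

Definition irreducible (W : {vspace V}) : Prop :=
  [/\ invariant W, W != 0%VS &
      forall U, invariant U -> (U <= W)%VS -> U = 0%VS \/ U = W].

Definition completely_reducible : Prop :=
  exists n (W : 'I_n -> {vspace V}),
    [/\ forall i, irreducible (W i), directv (\sum_i W i)%VS &
        (\sum_i W i)%VS = fullv].
End Submodules.

Definition FCR : Prop :=
  (forall (V : vectType K) (rho : A -> 'End(V)),
     representation rho -> completely_reducible rho) /\
  (forall a, (forall (V : vectType K) (rho : A -> 'End(V)),
     representation rho -> rho a = 0) -> a = 0).
End FCR.

Section Quot.
Variables (K : fieldType) (A : algType K).

Inductive ideal_gen (S : A -> Prop) : A -> Prop :=
| ideal_gen_mem a of S a : ideal_gen S a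
| ideal_gen0 : ideal_gen S 0
| ideal_genD a b of ideal_gen S a & ideal_gen S b : ideal_gen S (a + b)
| ideal_genMl a b of ideal_gen S b : ideal_gen S (a * b)
| ideal_genMr a b of ideal_gen S a : ideal_gen S (a * b).

Lemma ideal_gen_ker (B : algType K) (S : A -> Prop) (f : {lrmorphism A -> B}) :
  (forall a, S a -> f a = 0) -> forall a, ideal_gen S a -> f a = 0.
Proof.
move=> fS a; elim=> {a} //= [|a b _ IHa _ IHb|a b _ IHb|a b _ IHa].
- exact: raddf0.
- by rewrite raddfD /= IHa IHb addr0.
- by rewrite rmorphM /= IHb mulr0.
- by rewrite rmorphM /= IHa mul0r.
Qed.

(* [algType K] only has nonzero algebras, hence the properness condition. *)
Record proper_rel := ProperRel {
  rel_of :> A -> Prop;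
  rel_proper : ~ ideal_gen rel_of 1 }.

Definition ideal_pred (S : proper_rel) : {pred A} := fun a => `[< ideal_gen S a >].

Variable S : proper_rel.

Lemma ideal_predP a : reflect (ideal_gen S a) (a \in ideal_pred S).
Proof. exact: asboolP. Qed.

Lemma ideal_pred_zmod : zmod_closed (ideal_pred S).
Proof.
split=> [|a b /ideal_predP Ia /ideal_predP Ib]; apply/ideal_predP.
  exact: ideal_gen0.
by rewrite -mulN1r; apply: ideal_genD => //; apply: ideal_genMl.
Qed.
HB.instance Definition _ := GRing.isZmodClosed.Build A (ideal_pred S) ideal_pred_zmod.

Definition quot_alg : Type := Quotient.quot (ideal_pred S).
HB.instance Definition _ := GRing.Zmodule.on quot_alg.

Definition quot_pi (a : A) : quot_alg := \pi_(Quotient.quot (ideal_pred S)) a.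
Definition quot_repr (u : quot_alg) : A := repr (u : Quotient.quot (ideal_pred S)).

Lemma quot_reprK : cancel quot_repr quot_pi.
Proof. exact: reprK. Qed.

Lemma quot_pi_eq a b : quot_pi a = quot_pi b <-> ideal_gen S (a - b).
Proof.
split=> [/eqP|/ideal_predP].
  by rewrite /quot_pi -Quotient.idealrBE => /ideal_predP.
by rewrite Quotient.idealrBE => /eqP.
Qed.

Lemma quot_pi_zmod : zmod_morphism quot_pi.
Proof. by move=> a b; rewrite /quot_pi raddfB. Qed.
HB.instance Definition _ :=
  GRing.isZmodMorphism.Build A quot_alg quot_pi quot_pi_zmod.

Definition quot_mul : quot_alg -> quot_alg -> quot_alg :=
  locked (fun u v => quot_pi (quot_repr u * quot_repr v)).
Definition quot_scale : K -> quot_alg -> quot_alg :=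
  locked (fun k u => quot_pi (k *: quot_repr u)).

Lemma quot_repr_pi a : ideal_gen S (quot_repr (quot_pi a) - a).
Proof. by apply/quot_pi_eq; rewrite quot_reprK. Qed.

Lemma quot_piM a b : quot_pi (a * b) = quot_mul (quot_pi a) (quot_pi b).
Proof.
rewrite /quot_mul; unlock; apply/esym/quot_pi_eq.
set a' := quot_repr _; set b' := quot_repr _.
have -> : a' * b' - a * b = a' * (b' - b) + (a' - a) * b.
  by rewrite mulrBr mulrBl addrA subrK.
by apply: ideal_genD; [apply: ideal_genMl | apply: ideal_genMr];
  apply: quot_repr_pi.
Qed.

Lemma quot_piZ k a : quot_pi (k *: a) = quot_scale k (quot_pi a).
Proof.
rewrite /quot_scale; unlock; apply/esym/quot_pi_eq; rewrite -scalerBr -[_ - _]mul1r scalerAl.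
exact/ideal_genMl/quot_repr_pi.
Qed.

Lemma quot_ind (P : quot_alg -> Prop) : (forall a, P (quot_pi a)) -> forall u, P u.
Proof. by move=> h u; rewrite -[u]quot_reprK. Qed.

Fact quot_mulA : associative quot_mul.
Proof.
elim/quot_ind=> a; elim/quot_ind=> b; elim/quot_ind=> c.
by rewrite -!quot_piM mulrA.
Qed.
Fact quot_mul1 : left_id (quot_pi 1) quot_mul.
Proof. by elim/quot_ind=> a; rewrite -quot_piM mul1r. Qed.
Fact quot_mulr1 : right_id (quot_pi 1) quot_mul.
Proof. by elim/quot_ind=> a; rewrite -quot_piM mulr1. Qed.
Fact quot_mulDl : left_distributive quot_mul +%R.
Proof.
elim/quot_ind=> a; elim/quot_ind=> b; elim/quot_ind=> c.
by rewrite -raddfD -!quot_piM mulrDl raddfD.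
Qed.
Fact quot_mulDr : right_distributive quot_mul +%R.
Proof.
elim/quot_ind=> a; elim/quot_ind=> b; elim/quot_ind=> c.
by rewrite -raddfD -!quot_piM mulrDr raddfD.
Qed.
Fact quot_1neq0 : quot_pi 1 != 0.
Proof.
apply/eqP; rewrite -(raddf0 quot_pi) => /quot_pi_eq.
by rewrite subr0; apply: rel_proper.
Qed.
HB.instance Definition _ := GRing.Zmodule_isNzRing.Build quot_alg
  quot_mulA quot_mul1 quot_mulr1 quot_mulDl quot_mulDr quot_1neq0.

Fact quot_scaleA k l u : quot_scale k (quot_scale l u) = quot_scale (k * l) u.
Proof. by elim/quot_ind: u => a; rewrite -!quot_piZ scalerA. Qed.
Fact quot_scale1 : left_id 1 quot_scale.
Proof. by elim/quot_ind=> a; rewrite -quot_piZ scale1r. Qed.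
Fact quot_scaleDr : right_distributive quot_scale +%R.
Proof.
move=> k; elim/quot_ind=> a; elim/quot_ind=> b.
by rewrite -raddfD -!quot_piZ scalerDr raddfD.
Qed.
Fact quot_scaleDl u : {morph quot_scale^~ u : k l / k + l}.
Proof. by move=> k l; elim/quot_ind: u => a; rewrite -!quot_piZ scalerDl raddfD. Qed.
HB.instance Definition _ := GRing.Zmodule_isLmodule.Build K quot_alg
  quot_scaleA quot_scale1 quot_scaleDr quot_scaleDl.

Fact quot_scaleAl k (u v : quot_alg) : k *: (u * v) = (k *: u) * v.
Proof.
elim/quot_ind: u => a; elim/quot_ind: v => b.
by rewrite -[_ * _]quot_piM -![_ *: quot_pi _]quot_piZ -[RHS]quot_piM scalerAl.
Qed.
HB.instance Definition _ := GRing.Lmodule_isLalgebra.Build K quot_alg quot_scaleAl.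
Fact quot_scaleAr k (u v : quot_alg) : k *: (u * v) = u * (k *: v).
Proof.
elim/quot_ind: u => a; elim/quot_ind: v => b.
by rewrite -[_ * _]quot_piM -![_ *: quot_pi _]quot_piZ -[RHS]quot_piM scalerAr.
Qed.
HB.instance Definition _ := GRing.Lalgebra_isAlgebra.Build K quot_alg quot_scaleAr.

Fact quot_pi_monoid : monoid_morphism quot_pi.
Proof. by split=> // a b; rewrite quot_piM. Qed.
HB.instance Definition _ :=
  GRing.isMonoidMorphism.Build A quot_alg quot_pi quot_pi_monoid.
Fact quot_pi_scalable : scalable quot_pi.
Proof. by move=> k a; rewrite quot_piZ. Qed.
HB.instance Definition _ :=
  GRing.isScalable.Build K A quot_alg *:%R quot_pi quot_pi_scalable.

Lemma quot_pi_rel a : S a -> quot_pi a = 0.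
Proof.
move=> Sa; rewrite -(raddf0 quot_pi); apply/quot_pi_eq.
by rewrite subr0; apply: ideal_gen_mem.
Qed.

Section Lift.
Variables (B : algType K) (f : {lrmorphism A -> B}).
Hypothesis fS : forall a, S a -> f a = 0.

Definition quot_lift of (forall a, S a -> f a = 0) :=
  fun u : quot_alg => f (quot_repr u).

Lemma quot_liftE a : quot_lift fS (quot_pi a) = f a.
Proof.
apply/eqP; rewrite -subr_eq0 -raddfB; apply/eqP.
exact/(ideal_gen_ker fS)/quot_repr_pi.
Qed.

Fact quot_lift_zmod : zmod_morphism (quot_lift fS).
Proof.
elim/quot_ind=> a; elim/quot_ind=> b.
by rewrite -raddfB !quot_liftE raddfB.
Qed.
HB.instance Definition _ :=
  GRing.isZmodMorphism.Build quot_alg B (quot_lift fS) quot_lift_zmod.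
Fact quot_lift_monoid : monoid_morphism (quot_lift fS).
Proof.
split=> [|]; first by rewrite -(rmorph1 quot_pi) quot_liftE rmorph1.
by elim/quot_ind=> a; elim/quot_ind=> b; rewrite -rmorphM !quot_liftE rmorphM.
Qed.
HB.instance Definition _ :=
  GRing.isMonoidMorphism.Build quot_alg B (quot_lift fS) quot_lift_monoid.
Fact quot_lift_scalable : scalable (quot_lift fS).
Proof.
by move=> k; elim/quot_ind=> a; rewrite -linearZ !quot_liftE linearZ.
Qed.
HB.instance Definition _ :=
  GRing.isScalable.Build K quot_alg B *:%R (quot_lift fS) quot_lift_scalable.
End Lift.
End Quot.

Section FreeAlgebra.
Variables (K : fieldType) (V : choiceType).

Definition free_alg : Type := {malg K[{fmonom V}]}.
HB.instance Definition _ := GRing.Lalgebra.on free_alg.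

Fact free_scaleAr k (u v : free_alg) : k *: (u * v) = u * (k *: v).
Proof.
rewrite (malgMEw (fsubset_refl _) (msuppZ_le k v)) malgME scaler_sumr.
apply: eq_bigr => m _; rewrite scaler_sumr; apply: eq_bigr => n _.
apply/malgP=> p; rewrite mcoeffZ !mcoeffU mcoeffZ mulrCA.
by rewrite mulrnAr.
Qed.
HB.instance Definition _ := GRing.Lalgebra_isAlgebra.Build K free_alg free_scaleAr.

Definition free_gen (x : V) : free_alg := << fmu x >>.

Section Lift.
Variables (B : algType K) (f : V -> B).

Definition word_eval (m : {fmonom V}) : B := \prod_(x <- (m : seq V)) f x.
Fact word_eval_mmorphism : mmorphism word_eval.
Proof.
split=> [m n|]; first by rewrite /word_eval fmM big_cat.
by rewrite /word_eval fm1 big_nil.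
Qed.
HB.instance Definition _ := isMultiplicative.Build _ B word_eval word_eval_mmorphism.

Definition free_lift : free_alg -> B := mmap (in_alg B) word_eval.

Fact free_lift_zmod : zmod_morphism free_lift.
Proof. exact: mmap_is_additive. Qed.
HB.instance Definition _ :=
  GRing.isZmodMorphism.Build free_alg B free_lift free_lift_zmod.
Fact free_lift_monoid : monoid_morphism free_lift.
Proof.
have [] := @commr_mmap_is_multiplicative _ _ B (in_alg B) word_eval; last by [].
by move=> g m n; rewrite /GRing.comm /= -scalerAl -scalerAr mul1r mulr1.
Qed.
HB.instance Definition _ :=
  GRing.isMonoidMorphism.Build free_alg B free_lift free_lift_monoid.
Fact free_lift_scalable : scalable free_lift.
Proof.
by move=> k a; rewrite /free_lift (mmapZ (f := in_alg B)) /= -scalerAl mul1r.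
Qed.
HB.instance Definition _ :=
  GRing.isScalable.Build K free_alg B *:%R free_lift free_lift_scalable.

Lemma free_lift_gen x : free_lift (free_gen x) = f x.
Proof.
by rewrite /free_lift mmapU /= scale1r mul1r /word_eval fmU big_seq1.
Qed.
End Lift.

Lemma free_ind (P : free_alg -> Prop) :
  P 1 -> (forall x u, P u -> P (free_gen x * u)) ->
  (forall k u v, P u -> P v -> P (k *: u + v)) -> forall u, P u.
Proof.
move=> P1 PM PD.
have P0 : P 0 by rewrite -(addNr 1) -scaleN1r; apply: PD.
have Pm m : P << m >>.
  case: m; elim=> [|x s IHs]; first by rewrite -fmoneE; exact: P1.
  have -> : FMonom (x :: s) = mmul (fmu x) (FMonom s).
    by apply/eqP; rewrite fmP fmM fmU.
  have -> : << mmul (fmu x) (FMonom s) >> = free_gen x * (<< FMonom s >> : free_alg).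
    by rewrite malgM_def fgmulUU mulr1.
  exact: PM.
move=> u; rewrite (monalgE u); elim/big_rec: _ => // m v _ Pv.
have -> : << u@_m *g m >> = u@_m *: (<< m >> : free_alg).
  by apply/malgP=> p; rewrite mcoeffZ !mcoeffU mulrnAr mulr1.
exact: PD.
Qed.
End FreeAlgebra.

Section Tensor.
Variables (K : fieldType) (V : lmodType K).

(* T(V) is the free algebra on the set V modulo linearity of the generators:
   in degree n this is the space spanned by all words [x_1 ... x_n] modulo
   multilinearity, i.e. the n-th tensor power of V. *)
Inductive lin_rel : free_alg K V -> Prop :=
| lin_relD x y : lin_rel (free_gen K (x + y) - (free_gen K x + free_gen K y))
| lin_relZ k x : lin_rel (free_gen K (k *: x) - k *: free_gen K x).

Lemma free_lift_lin_rel (B : algType K) (f : {linear V -> B}) a :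
  lin_rel a -> free_lift f a = 0.
Proof.
case=> [x y|k x]; rewrite raddfB /= free_lift_gen.
  by rewrite [free_lift _ _]raddfD /= !free_lift_gen -raddfD subrr.
by rewrite [free_lift _ _]linearZ /= free_lift_gen -linearZ subrr.
Qed.

Fact lin_rel_proper : ~ ideal_gen lin_rel 1.
Proof.
move/(ideal_gen_ker (@free_lift_lin_rel K^o \0)).
by rewrite rmorph1 => /eqP; rewrite oner_eq0.
Qed.

Definition tens : Type := quot_alg (ProperRel lin_rel_proper).
HB.instance Definition _ := GRing.Algebra.on tens.

Definition tens_in (x : V) : tens :=
  quot_pi (ProperRel lin_rel_proper) (free_gen K x).

Fact tens_in_linear : linear tens_in.
Proof.
move=> k x y; rewrite /tens_in -linearZ -raddfD; apply/eqP.
rewrite -subr_eq0 -raddfB /=; apply/eqP.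
have -> : free_gen K (k *: x + y) - (k *: free_gen K x + free_gen K y) =
    (free_gen K (k *: x + y) - (free_gen K (k *: x) + free_gen K y)) +
    (free_gen K (k *: x) - k *: free_gen K x).
  rewrite -[RHS]addrA [- (free_gen K (k *: x) + _)]opprD addrACA addNr add0r.
  by rewrite -opprD [free_gen K y + _]addrC.
rewrite raddfD /= !quot_pi_rel ?addr0 //=; first exact: lin_relZ.
exact: lin_relD.
Qed.
HB.instance Definition _ := GRing.isLinear.Build K V tens *:%R tens_in tens_in_linear.

Section Lift.
Variables (B : algType K) (f : {linear V -> B}).

Definition tens_lift : tens -> B :=
  quot_lift (S := ProperRel lin_rel_proper) (f := free_lift f) (@free_lift_lin_rel B f).
HB.instance Definition _ := GRing.LRMorphism.on tens_lift.

Lemma tens_liftE x : tens_lift (tens_in x) = f x.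
Proof. by rewrite /tens_lift quot_liftE /= free_lift_gen. Qed.
End Lift.

Lemma tens_ind (P : tens -> Prop) :
  P 1 -> (forall x u, P u -> P (tens_in x * u)) ->
  (forall k u v, P u -> P v -> P (k *: u + v)) -> forall u, P u.
Proof.
move=> P1 PM PD; elim/quot_ind; elim/free_ind=> [|x u Pu|k u v Pu Pv].
- by rewrite rmorph1.
- by rewrite rmorphM; apply: PM.
- by rewrite linearP; apply: PD.
Qed.
End Tensor.

Section ColorLie.
Variables (K : fieldType) (G : zmodType).

(* Abelian groups are written additively. *)
Record bicharacter := Bicharacter {
  bichar :> G -> G -> K;
  bichar_neq0 : forall g h, bichar g h != 0;
  bichar_antisym : forall g h, bichar g h * bichar h g = 1;
  bicharDr : forall g h k, bichar g (h + k) = bichar g h * bichar g k;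
  bicharDl : forall g h k, bichar (g + h) k = bichar g k * bichar h k }.

(* V is the direct sum of the V_g; G may be infinite. *)
Definition is_grading (V : vectType K) (Vg : G -> {vspace V}) : Prop :=
  (forall x, exists s : seq G, x \in (\sum_(g <- s) Vg g)%VS) /\
  (forall (s : seq G) (f : G -> V), uniq s -> (forall g, f g \in Vg g) ->
     \sum_(g <- s) f g = 0 -> forall g, g \in s -> f g = 0).

Record colorLie (eps : bicharacter) := ColorLie {
  cl_space :> vectType K;
  cl_comp : G -> {vspace cl_space};
  cl_br : cl_space -> cl_space -> cl_space;
  cl_grading : is_grading cl_comp;
  cl_br_linearl : forall y, linear (cl_br^~ y);
  cl_br_linearr : forall x, linear (cl_br x);
  cl_br_comp : forall g h x y, x \in cl_comp g -> y \in cl_comp h ->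
    cl_br x y \in cl_comp (g + h);
  cl_br_antisym : forall g h x y, x \in cl_comp g -> y \in cl_comp h ->
    cl_br x y = - (eps g h *: cl_br y x);
  cl_jacobi : forall g h k x y z,
    x \in cl_comp g -> y \in cl_comp h -> z \in cl_comp k ->
    eps k g *: cl_br x (cl_br y z) + eps g h *: cl_br y (cl_br z x)
      + eps h k *: cl_br z (cl_br x y) = 0 }.
End ColorLie.

Arguments cl_br {K G eps} c x y.

Section Bracket.
Variables (K : fieldType) (G : zmodType) (eps : bicharacter K G).
Variable L : colorLie eps.

HB.instance Definition _ x :=
  GRing.isLinear.Build K L L *:%R (cl_br L x) (cl_br_linearr x).
Definition cl_rbr (y x : L) : L := cl_br L x y.
HB.instance Definition _ y :=
  GRing.isLinear.Build K L L *:%R (cl_rbr y) (cl_br_linearl y).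

Lemma cl_br_sum (I J : Type) (r : seq I) (s : seq J) (P : pred I) (Q : pred J)
    (f : I -> L) (f' : J -> L) :
  cl_br L (\sum_(i <- r | P i) f i) (\sum_(j <- s | Q j) f' j) =
  \sum_(i <- r | P i) \sum_(j <- s | Q j) cl_br L (f i) (f' j).
Proof.
rewrite -[LHS]/(cl_rbr _ _) raddf_sum; apply: eq_bigr => i _ /=.
by rewrite /cl_rbr raddf_sum.
Qed.

Lemma cl_brZ k l x y : cl_br L (k *: x) (l *: y) = (k * l) *: cl_br L x y.
Proof. by rewrite linearZ /= -[cl_br L _ y]/(cl_rbr y _) linearZ /= scalerA mulrC. Qed.

Lemma cl_br0l x : cl_br L 0 x = 0.
Proof. exact: (raddf0 (cl_rbr x)). Qed.
Lemma cl_br0r x : cl_br L x 0 = 0.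
Proof. exact: raddf0. Qed.
End Bracket.

Section Enveloping.
Variables (K : fieldType) (G : zmodType) (eps : bicharacter K G).
Variable L : colorLie eps.

Inductive env_rel : tens L -> Prop :=
| EnvRel g h x y of x \in cl_comp L g & y \in cl_comp L h :
    env_rel (tens_in x * tens_in y - eps g h *: (tens_in y * tens_in x)
             - tens_in (cl_br L x y)).

Lemma env_rel_lift (B : algType K) (f : {linear L -> B}) :
  (forall g h x y, x \in cl_comp L g -> y \in cl_comp L h ->
     f x * f y = eps g h *: (f y * f x) + f (cl_br L x y)) ->
  forall a, env_rel a -> tens_lift f a = 0.
Proof.
move=> fP a [g h x y xg yh]; rewrite !raddfB /= linearZ !rmorphM /= !tens_liftE.
by rewrite (fP _ _ _ _ xg yh) addrAC addrK subrr.
Qed.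

Fact env_rel_proper : ~ ideal_gen env_rel 1.
Proof.
have fP g h (x y : L) : x \in cl_comp L g -> y \in cl_comp L h ->
    0 * 0 = eps g h *: (0 * 0) + 0 :> K^o.
  by rewrite !mul0r scaler0 addr0.
move/(ideal_gen_ker (@env_rel_lift K^o \0 fP)).
by rewrite rmorph1 => /eqP; rewrite oner_eq0.
Qed.

Definition enveloping : Type := quot_alg (ProperRel env_rel_proper).
HB.instance Definition _ := GRing.Algebra.on enveloping.

Definition env_in (x : L) : enveloping := quot_pi (ProperRel env_rel_proper) (tens_in x).
Fact env_in_linear : linear env_in.
Proof. by move=> k x y; rewrite /env_in !linearP. Qed.
HB.instance Definition _ := GRing.isLinear.Build K L enveloping *:%R env_in env_in_linear.
Lemma env_inZ k x : env_in (k *: x) = k *: env_in x.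
Proof. exact: linearZ. Qed.

Lemma env_inM g h (x y : L) : x \in cl_comp L g -> y \in cl_comp L h ->
  env_in x * env_in y = eps g h *: (env_in y * env_in x) + env_in (cl_br L x y).
Proof.
move=> xg yh; apply/eqP; rewrite -subr_eq0 opprD addrA; apply/eqP.
have := quot_pi_rel (S := ProperRel env_rel_proper) (EnvRel xg yh).
by rewrite !raddfB /= linearZ /= !rmorphM.
Qed.

Section Lift.
Variables (B : algType K) (f : {linear L -> B}).
Hypothesis fP : forall g h x y, x \in cl_comp L g -> y \in cl_comp L h ->
  f x * f y = eps g h *: (f y * f x) + f (cl_br L x y).

Definition env_lift : enveloping -> B :=
  quot_lift (S := ProperRel env_rel_proper) (f := tens_lift f) (env_rel_lift fP).
HB.instance Definition _ := GRing.LRMorphism.on env_lift.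

Lemma env_liftE x : env_lift (env_in x) = f x.
Proof. by rewrite /env_lift quot_liftE /= tens_liftE. Qed.
End Lift.

Lemma env_ind (P : enveloping -> Prop) :
  P 1 -> (forall x u, P u -> P (env_in x * u)) ->
  (forall k u v, P u -> P v -> P (k *: u + v)) -> forall u, P u.
Proof.
move=> P1 PM PD; elim/quot_ind; elim/tens_ind=> [|x u Pu|k u v Pu Pv].
- by rewrite rmorph1.
- by rewrite rmorphM; apply: PM.
- by rewrite linearP; apply: PD.
Qed.

(* The G-grading of U(L): [env_comp g u] says that u is homogeneous of
   degree g. *)
Inductive env_comp : G -> enveloping -> Prop :=
| env_comp1 : env_comp 0 1
| env_compM g h x u of x \in cl_comp L g & env_comp h u :
    env_comp (g + h) (env_in x * u)
| env_comp0 g : env_comp g 0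
| env_compP g k u v of env_comp g u & env_comp g v : env_comp g (k *: u + v).
End Enveloping.
Arguments env_in {K G eps} L x.

Section FiniteGrading.
Variables (K : fieldType) (G : finZmodType) (eps : bicharacter K G).
Variable L : colorLie eps.

Definition cl_proj (g : G) : 'End(L) := sumv_pi (\sum_h cl_comp L h)%VS g.

Lemma cl_proj_comp g x : cl_proj g x \in cl_comp L g.
Proof. exact: memv_sum_pi. Qed.

Lemma cl_proj_sum x : \sum_g cl_proj g x = x.
Proof.
apply: sumv_pi_sum; have [s] := (cl_grading L).1 x.
apply: subvP; rewrite big_seq; elim/big_rec: _ => [|g U _ sU]; first exact: sub0v.
by rewrite subv_add sU andbT; apply: sumv_sup.
Qed.

Lemma cl_grading_inj (f f' : G -> L) :
  (forall g, f g \in cl_comp L g) -> (forall g, f' g \in cl_comp L g) ->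
  \sum_g f g = \sum_g f' g -> forall g, f g = f' g.
Proof.
move=> fL f'L e g; apply/eqP; rewrite -subr_eq0; apply/eqP.
apply: ((cl_grading L).2 (enum G) (fun g => f g - f' g)); rewrite ?enum_uniq //.
- by move=> h; rewrite memvB.
- by rewrite big_enum sumrB e subrr.
- by rewrite mem_enum.
Qed.

Lemma cl_projE g h x : x \in cl_comp L g -> cl_proj h x = if h == g then x else 0.
Proof.
move=> xg; apply: (cl_grading_inj (f := cl_proj^~ x)
  (f' := fun h => if h == g then x else 0)) => [k|k|].
- exact: cl_proj_comp.
- by case: eqP => [->|_] //; rewrite mem0v.
- by rewrite cl_proj_sum -big_mkcond big_pred1_eq.
Qed.
End FiniteGrading.

Section Augmented.
Variables (K : fieldType) (G : finZmodType) (eps : bicharacter K G).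
Variable L : colorLie eps.

Lemma bichar0r g : eps g 0 = 1.
Proof.
by apply: (mulfI (bichar_neq0 eps g 0)); rewrite -bicharDr addr0 mulr1.
Qed.
Lemma bichar0l g : eps 0 g = 1.
Proof.
by apply: (mulfI (bichar_neq0 eps 0 g)); rewrite -bicharDl addr0 mulr1.
Qed.

Lemma mulZZ (A : algType K) k l (u v : A) : (k *: u) * (l *: v) = (k * l) *: (u * v).
Proof. by rewrite -scalerAl -scalerAr scalerA. Qed.

Definition cl_act (h : G) (x : L) : L := \sum_g eps g h *: cl_proj L g x.
Fact cl_act_linear h : linear (cl_act h).
Proof.
move=> k x y; rewrite /cl_act scaler_sumr -big_split; apply: eq_bigr => g _ /=.
by rewrite linearP scalerDr !scalerA mulrC.
Qed.
HB.instance Definition _ h := GRing.isLinear.Build K L L *:%R (cl_act h) (cl_act_linear h).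

Lemma cl_actE g h x : x \in cl_comp L g -> cl_act h x = eps g h *: x.
Proof.
move=> xg; rewrite /cl_act (bigD1 g) //= big1 => [|k /negPf kg].
  by rewrite addr0 (cl_projE _ xg) eqxx.
by rewrite (cl_projE _ xg) kg scaler0.
Qed.

Fact env_act_rel h g k (x y : L) : x \in cl_comp L g -> y \in cl_comp L k ->
  (env_in L \o cl_act h) x * (env_in L \o cl_act h) y =
  eps g k *: ((env_in L \o cl_act h) y * (env_in L \o cl_act h) x)
    + (env_in L \o cl_act h) (cl_br L x y).
Proof.
move=> xg yk; rewrite /= (cl_actE _ xg) (cl_actE _ yk).
rewrite (cl_actE _ (cl_br_comp xg yk)) !env_inZ /=.
rewrite 2!mulZZ (env_inM xg yk) bicharDl scalerDr 2!scalerA.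
by rewrite [eps g k * _]mulrC [eps k h * _]mulrC.
Qed.

(* The automorphism u |-> eps(|u|, h) u of U(L); see env_actE. *)
Definition env_act (h : G) : enveloping L -> enveloping L := env_lift (@env_act_rel h).
HB.instance Definition _ h := GRing.LRMorphism.on (env_act h).

Lemma env_act_in h x : env_act h (env_in L x) = env_in L (cl_act h x).
Proof. exact: env_liftE. Qed.

Lemma env_actE g h u : env_comp g u -> env_act h u = eps g h *: u.
Proof.
elim=> {g u} [|g k x u xg _ IH|g|g k u v _ IHu _ IHv].
- by rewrite rmorph1 bichar0l scale1r.
- rewrite rmorphM /= IH env_act_in (cl_actE _ xg) env_inZ.
  by rewrite mulZZ bicharDl.
- by rewrite raddf0 scaler0.
- by rewrite linearP /= IHu IHv scalerDr !scalerA mulrC.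
Qed.

Lemma env_comp_sum u :
  exists2 f : G -> enveloping L, (forall g, env_comp g (f g)) & u = \sum_g f g.
Proof.
elim/env_ind: u => [|x u [f fP ->]|k u v [f fP ->] [f' f'P ->]].
- exists (fun g => if g == 0 then 1 else 0) => [g|].
    by case: eqP => [->|_]; [apply: env_comp1 | apply: env_comp0].
  by rewrite -big_mkcond big_pred1_eq.
- exists (fun k => \sum_g env_in L (cl_proj L g x) * f (k - g)) => [k|].
    elim/big_ind: _ => [|v w kv kw|g _]; first exact: env_comp0.
      by rewrite -[v]scale1r; apply: env_compP.
    by rewrite -[k in env_comp k](subrKC g); apply: env_compM; rewrite ?cl_proj_comp.
  rewrite exchange_big /= -{1}[x]cl_proj_sum raddf_sum mulr_suml /=.
  apply: eq_bigr => g _; rewrite -mulr_sumr; congr (_ * _).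
  by rewrite [LHS](reindex_inj (addIr (- g))).
- exists (fun g => k *: f g + f' g) => [g|]; first exact: env_compP.
  by rewrite big_split /= scaler_sumr.
Qed.

Lemma env_act0 u : env_act 0 u = u.
Proof.
have [f fP ->] := env_comp_sum u; rewrite raddf_sum; apply: eq_bigr => g _.
by rewrite /= (env_actE _ (fP g)) bichar0r scale1r.
Qed.

Lemma env_actD h k u : env_act (h + k) u = env_act h (env_act k u).
Proof.
have [f fP ->] := env_comp_sum u; rewrite [env_act k _]raddf_sum !raddf_sum /=.
apply: eq_bigr => g _; rewrite !(env_actE _ (fP g)) linearZ /= (env_actE _ (fP g)).
by rewrite scalerA bicharDr mulrC.
Qed.

(* KG (x) U(L), where f : {ffun G -> enveloping L} stands for \sum_g g (x) f g (see
   aug_tens_sum).  The product is the bilinear extension of the defining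
   formula (g (x) u)(h (x) v) = eps(|u|, h) gh (x) uv, see aug_tensM; it is
   determined by it since homogeneous elements span U(L) (env_comp_sum). *)
Definition augmented : Type := {ffun G -> enveloping L}.
HB.instance Definition _ := GRing.Lmodule.on augmented.

Lemma augP (a b : augmented) : (forall g, a g = b g) -> a = b.
Proof. by move=> ab; apply: (iffLR (ffunP a b)). Qed.

Definition aug_tens (g : G) (u : enveloping L) : augmented := [ffun h => if h == g then u else 0].
Definition aug_one : augmented := aug_tens 0 1.
Definition aug_mul (a b : augmented) : augmented :=
  [ffun k => \sum_h env_act h (a (k - h)) * b h].

Fact aug_tens_linear g : linear (aug_tens g).
Proof.
move=> k u v; apply: augP => h; rewrite !ffunE.
by case: ifP => // _; rewrite scaler0 addr0.
Qed.
HB.instance Definition _ g :=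
  GRing.isLinear.Build K (enveloping L) augmented *:%R (aug_tens g) (aug_tens_linear g).

Lemma aug_tens_sum (a : augmented) : a = \sum_g aug_tens g (a g).
Proof.
apply: augP=> h; rewrite sum_ffunE (bigD1 h) //= ffunE eqxx big1 ?addr0 //.
by move=> g /negPf gh; rewrite ffunE eq_sym gh.
Qed.

Lemma aug_tens_mul g h u v :
  aug_mul (aug_tens g u) (aug_tens h v) = aug_tens (g + h) (env_act h u * v).
Proof.
apply: augP=> k; rewrite !ffunE (bigD1 h) //= !ffunE eqxx big1 ?addr0.
  by rewrite subr_eq; case: ifP => // _; rewrite raddf0 mul0r.
by move=> l /negPf lh; rewrite !ffunE lh mulr0.
Qed.

Fact aug_mulDl : left_distributive aug_mul +%R.
Proof.
move=> a b c; apply: augP=> k; rewrite !ffunE -big_split; apply: eq_bigr => h _.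
by rewrite /= ffunE raddfD mulrDl.
Qed.
Fact aug_mulDr : right_distributive aug_mul +%R.
Proof.
move=> a b c; apply: augP=> k; rewrite !ffunE -big_split; apply: eq_bigr => h _.
by rewrite /= ffunE mulrDr.
Qed.
Fact aug_mulA : associative aug_mul.
Proof.
have mul0a a : aug_mul 0 a = 0.
  by apply: (addIr (aug_mul 0 a)); rewrite -aug_mulDl !add0r.
have mula0 a : aug_mul a 0 = 0.
  by apply: (addIr (aug_mul a 0)); rewrite -aug_mulDr !add0r.
move=> a b c; rewrite (aug_tens_sum a) (aug_tens_sum b) (aug_tens_sum c).
elim/big_rec: _ => [|g a' _ IHa]; first by rewrite !mul0a.
rewrite !aug_mulDl IHa; congr (_ + _) => {IHa}.
elim/big_rec: _ => [|h b' _ IHb]; first by rewrite !(mul0a, mula0).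
rewrite !(aug_mulDl, aug_mulDr) IHb; congr (_ + _) => {IHb}.
elim/big_rec: _ => [|k c' _ IHc]; first by rewrite !mula0.
rewrite !aug_mulDr IHc; congr (_ + _) => {IHc}.
by rewrite !aug_tens_mul rmorphM /= -env_actD addrA mulrA [k + h]addrC.
Qed.
Fact aug_mul1 : left_id aug_one aug_mul.
Proof.
move=> a; apply: augP=> k; rewrite ffunE (bigD1 k) //= ffunE subrr eqxx rmorph1.
rewrite mul1r big1 ?addr0 // => h hk.
by rewrite ffunE subr_eq0 eq_sym (negPf hk) raddf0 mul0r.
Qed.
Fact aug_mulr1 : right_id aug_one aug_mul.
Proof.
move=> a; apply: augP=> k; rewrite ffunE (bigD1 0) //= ffunE eqxx mulr1 subr0.
rewrite env_act0 big1 ?addr0 // => h hk.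
by rewrite ffunE (negPf hk) mulr0.
Qed.
Fact aug_1neq0 : aug_one != 0.
Proof. by apply/eqP=> /ffunP/(_ 0)/eqP; rewrite !ffunE eqxx oner_eq0. Qed.
HB.instance Definition _ := GRing.Zmodule_isNzRing.Build augmented
  aug_mulA aug_mul1 aug_mulr1 aug_mulDl aug_mulDr aug_1neq0.

Fact aug_scaleAl k (a b : augmented) : k *: (a * b) = (k *: a) * b.
Proof.
apply: augP=> g; rewrite !ffunE scaler_sumr; apply: eq_bigr => h _.
by rewrite ffunE linearZ scalerAl.
Qed.
HB.instance Definition _ := GRing.Lmodule_isLalgebra.Build K augmented aug_scaleAl.
Fact aug_scaleAr k (a b : augmented) : k *: (a * b) = a * (k *: b).
Proof.
apply: augP=> g; rewrite !ffunE scaler_sumr; apply: eq_bigr => h _.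
by rewrite ffunE scalerAr.
Qed.
HB.instance Definition _ := GRing.Lalgebra_isAlgebra.Build K augmented aug_scaleAr.

Lemma aug_tensM g h a u v : env_comp a u ->
  aug_tens g u * aug_tens h v = eps a h *: aug_tens (g + h) (u * v).
Proof.
by move=> ua; rewrite [LHS]aug_tens_mul (env_actE _ ua) -scalerAl linearZ.
Qed.
End Augmented.

Section Twist.
Variables (K : fieldType) (G : finZmodType) (G' : zmodType).

Record cocycle := Cocycle {
  cocycle_fun :> G -> G -> K;
  cocycle_neq0 : forall g h, cocycle_fun g h != 0;
  cocycleP : forall g h k, cocycle_fun g h * cocycle_fun (g + h) k =
                           cocycle_fun h k * cocycle_fun g (h + k) }.

Variables (eps : bicharacter K G) (L : colorLie eps).
Variables (c : cocycle) (phi : {additive G -> G'}) (eps' : bicharacter K G').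

Definition twist_compatible : Prop :=
  forall g h, eps g h * c g h = c h g * eps' (phi g) (phi h).

Definition twist_comp (g' : G') : {vspace L} :=
  (\sum_(g | phi g == g') cl_comp L g)%VS.

(* The bilinear bracket with <x,y>^c = c(g,h) <x,y> on L_g x L_h: see
   twist_brE. *)
Definition twist_br (x y : L) : L :=
  \sum_g \sum_h c g h *: cl_br L (cl_proj L g x) (cl_proj L h y).

Lemma twist_brE g h x y : x \in cl_comp L g -> y \in cl_comp L h ->
  twist_br x y = c g h *: cl_br L x y.
Proof.
move=> xg yh; rewrite /twist_br (bigD1 g) //= (bigD1 h) //=.
rewrite (cl_projE _ xg) (cl_projE _ yh) !eqxx !big1 ?addr0 // => k /negPf kg.
  by apply: big1 => l _; rewrite (cl_projE _ xg) kg cl_br0l scaler0.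
by rewrite (cl_projE _ yh) kg cl_br0r scaler0.
Qed.

Lemma twist_br_linearl y : linear (twist_br^~ y).
Proof.
move=> k x x'; rewrite /twist_br scaler_sumr -big_split; apply: eq_bigr => g _.
rewrite /= scaler_sumr -big_split; apply: eq_bigr => h _ /=.
by rewrite linearP cl_br_linearl scalerDr !scalerA mulrC.
Qed.
Lemma twist_br_linearr x : linear (twist_br x).
Proof.
move=> k y y'; rewrite /twist_br scaler_sumr -big_split; apply: eq_bigr => g _.
rewrite /= scaler_sumr -big_split; apply: eq_bigr => h _ /=.
by rewrite linearP cl_br_linearr scalerDr !scalerA mulrC.
Qed.

Lemma twist_comp_sub g g' : phi g = g' -> (cl_comp L g <= twist_comp g')%VS.
Proof. by move=> /eqP gg'; apply: sumv_sup gg' _. Qed.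

Lemma twist_comp_proj g' x : x \in twist_comp g' ->
  x = \sum_(g | phi g == g') cl_proj L g x.
Proof.
move=> /memv_sumP[f fL ->]; apply: eq_bigr => g gg'.
rewrite raddf_sum /= (bigD1 g) //= (cl_projE _ (fL _ gg')) eqxx big1 ?addr0 //.
move=> h /andP[hg' /negPf hg]; by rewrite (cl_projE _ (fL _ hg')) eq_sym hg.
Qed.

Lemma twist_comp_proj0 g g' x : x \in twist_comp g' -> phi g != g' ->
  cl_proj L g x = 0.
Proof.
move=> /twist_comp_proj-> gg'; rewrite raddf_sum big1 //= => h hg'.
rewrite (cl_projE _ (cl_proj_comp h x)); case: eqP => // gh.
by rewrite gh hg' in gg'.
Qed.

Lemma twist_grading : is_grading twist_comp.
Proof.
split=> [x|s f s_uniq fL f0 g' sg'].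
  exists (undup [seq phi g | g <- enum G]).
  rewrite -[x]cl_proj_sum rpred_sum // => g _.
  apply: subvP (cl_proj_comp g x).
  rewrite (bigD1_seq (phi g)) ?undup_uniq //=; last first.
    by rewrite mem_undup map_f ?mem_enum.
  by apply: subv_trans (addvSl _ _); apply: twist_comp_sub.
rewrite (twist_comp_proj (fL g')) big1 // => g /eqP gg'.
have := congr1 (cl_proj L g) f0; rewrite raddf0 raddf_sum /= (bigD1_seq g') //=.
rewrite big1 ?addr0 // => h' h'g'; apply: twist_comp_proj0 (fL h') _.
by rewrite gg' eq_sym.
Qed.

Lemma twist_br_comp g' h' x y : x \in twist_comp g' -> y \in twist_comp h' ->
  twist_br x y \in twist_comp (g' + h').
Proof.
move=> xg' yh'; apply: rpred_sum => g _; apply: rpred_sum => h _.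
apply: rpredZ; have [gg'|/eqP gg'] := phi g =P g'; last first.
  by rewrite (twist_comp_proj0 xg' gg') cl_br0l rpred0.
have [hh'|/eqP hh'] := phi h =P h'; last first.
  by rewrite (twist_comp_proj0 yh' hh') cl_br0r rpred0.
apply: subvP (twist_comp_sub _) _ (cl_br_comp (cl_proj_comp g x) (cl_proj_comp h y)).
by rewrite raddfD /= gg' hh'.
Qed.

HB.instance Definition _ x :=
  GRing.isLinear.Build K L L *:%R (twist_br x) (twist_br_linearr x).

Lemma twist_br2E x y z : twist_br x (twist_br y z) =
  \sum_h \sum_k \sum_g (c h k * c g (h + k)) *:
     cl_br L (cl_proj L g x) (cl_br L (cl_proj L h y) (cl_proj L k z)).
Proof.
rewrite [twist_br y z]/twist_br raddf_sum /=; apply: eq_bigr => h _.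
rewrite raddf_sum /=; apply: eq_bigr => k _; rewrite linearZ /= /twist_br.
have yz := cl_br_comp (cl_proj_comp h y) (cl_proj_comp k z).
rewrite scaler_sumr; apply: eq_bigr => g _; rewrite (bigD1 (h + k)) //= big1.
  by rewrite (cl_projE _ yz) eqxx addr0 scalerA.
by move=> l /negPf hkl; rewrite (cl_projE _ yz) hkl cl_br0r scaler0.
Qed.

Hypothesis ce : twist_compatible.

Lemma twist_br_antisym g' h' x y : x \in twist_comp g' -> y \in twist_comp h' ->
  twist_br x y = - (eps' g' h' *: twist_br y x).
Proof.
move=> xg' yh'; rewrite /twist_br [X in _ *: X]exchange_big /= scaler_sumr -sumrN.
apply: eq_bigr => g _; rewrite scaler_sumr -sumrN; apply: eq_bigr => h _.
have [gg'|/eqP gg'] := phi g =P g'; last first.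
  by rewrite (twist_comp_proj0 xg' gg') cl_br0l cl_br0r !scaler0 oppr0.
have [hh'|/eqP hh'] := phi h =P h'; last first.
  by rewrite (twist_comp_proj0 yh' hh') cl_br0l cl_br0r !scaler0 oppr0.
rewrite (cl_br_antisym (cl_proj_comp g x) (cl_proj_comp h y)) scalerN !scalerA.
by congr (- (_ *: _)); rewrite mulrC ce gg' hh' mulrC.
Qed.

Lemma twist_jacobi_coef g h k :
  let J := c h k * c g (h + k) * c k g / c g k in
  [/\ eps' (phi k) (phi g) * (c h k * c g (h + k)) = J * eps k g,
      eps' (phi g) (phi h) * (c k g * c h (k + g)) = J * eps g h &
      eps' (phi h) (phi k) * (c g h * c k (g + h)) = J * eps h k].
Proof.
have e' a b : eps' (phi a) (phi b) = eps a b * c a b / c b a.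
  by rewrite ce mulrAC mulfV ?mul1r ?cocycle_neq0.
have := cocycle_neq0 c; move=> n0.
rewrite /= !e'; split.
- by field; rewrite n0.
- have e1 := cocycleP c g h k; have e2 := cocycleP c h g k.
  rewrite [k + g]addrC.
  have -> : c h (g + k) = c h g * c (h + g) k / c g k.
    by rewrite e2 mulrAC mulfV ?mul1r.
  by rewrite -e1 [h + g]addrC; field; rewrite !n0.
- have e1 := cocycleP c g h k; have e2 := cocycleP c h k g; have e3 := cocycleP c k h g.
  have e4 := cocycleP c h g k.
  rewrite -e1.
  have -> : c k (g + h) = c k h * c (k + h) g / c h g.
    by rewrite [g + h]addrC e3 mulrAC mulfV ?mul1r.
  have -> : c (g + h) k = c g k * c h (g + k) / c h g.
    by rewrite -e4 [g + h]addrC mulrAC mulfV ?mul1r.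
  have -> : c h (g + k) = c h k * c (h + k) g / c k g.
    by rewrite e2 [g + k]addrC mulrAC mulfV ?mul1r.
  rewrite [k + h]addrC; field; by rewrite !n0.
Qed.

Lemma twist_jacobi g' h' k' x y z :
  x \in twist_comp g' -> y \in twist_comp h' -> z \in twist_comp k' ->
  eps' k' g' *: twist_br x (twist_br y z) + eps' g' h' *: twist_br y (twist_br z x)
    + eps' h' k' *: twist_br z (twist_br x y) = 0.
Proof.
move=> xg' yh' zk'; rewrite !twist_br2E.
have rot (F : G -> G -> G -> L) :
    \sum_h \sum_k \sum_g F g h k = \sum_g \sum_h \sum_k F g h k.
  by under eq_bigr do rewrite exchange_big /=; rewrite exchange_big.
rewrite [X in _ *: X + _ *: _ + _]rot.
do 2![rewrite [X in _ *: _ + _ *: X + _]rot].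
rewrite !scaler_sumr -!big_split big1 // => g _.
rewrite /= !scaler_sumr -!big_split big1 // => h _.
rewrite /= !scaler_sumr -!big_split big1 // => k _ /=.
have [gg'|/eqP gg'] := phi g =P g'; last first.
  by rewrite (twist_comp_proj0 xg' gg') !(cl_br0l, cl_br0r, scaler0, addr0).
have [hh'|/eqP hh'] := phi h =P h'; last first.
  by rewrite (twist_comp_proj0 yh' hh') !(cl_br0l, cl_br0r, scaler0, addr0).
have [kk'|/eqP kk'] := phi k =P k'; last first.
  by rewrite (twist_comp_proj0 zk' kk') !(cl_br0l, cl_br0r, scaler0, addr0).
rewrite -gg' -hh' -kk' !scalerA.
move: (twist_jacobi_coef g h k) => /=.
move: (_ / c g k) => J [-> -> ->].
rewrite -!scalerA -!scalerDr.
by rewrite (cl_jacobi (cl_proj_comp g x) (cl_proj_comp h y) (cl_proj_comp k z)) scaler0.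
Qed.

Definition cocycle_twist : colorLie eps' :=
  ColorLie twist_grading twist_br_linearl twist_br_linearr twist_br_comp
    twist_br_antisym twist_jacobi.
End Twist.

(* Main.v *)
(** A finite-dimensional representation is completely reducible iff every
    invariant subspace W of V admits an equivariant retraction V -> W, so the
    first half of FCR amounts to producing retractions.

    (1) Both U(L) and U(L^c) are generated by L with relations indexed by G.
    Sending x in L_g to g (x) x embeds U(L^c) in K_cG (x) U(L) and U(L) in
    K_{c^-1}G (x) U(L^c), which gives the separation of points.  Given a
    representation V of U(L^c) and a U(L)-equivariant retraction p of V (x) KG
    onto W (x) KG, the scalars c and c^-1 cancel in the average over h of the
    h-component of p (v (x) h), which is therefore a U(L^c)-equivariant
    retraction of V onto W.

    (2) The augmented algebra is a skew group algebra of G over U(L).  Going up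
    is Maschke's averaging argument.  Going down, V is the component of degree 0
    of the induced representation on V (x) KG, and retractions of the latter
    restrict to it. *)
From Pilot Require Import Defs.
From HB Require Import structures.
From mathcomp Require Import all_boot all_order all_algebra.
From mathcomp Require boolp.

Set Implicit Arguments.
Unset Strict Implicit.
Unset Printing Implicit Defensive.

Import GRing.Theory.
Local Open Scope ring_scope.

Local Notation invariant := Pilot.Defs.invariant.

(** * Complete reducibility versus equivariant retractions *)

Section Splitting.
Variables (K : fieldType) (A : algType K) (V : vectType K) (rho : A -> 'End(V)).

Definition splits : Prop :=
  forall W, invariant rho W -> exists p : 'End(V),
    [/\ forall v, p v \in W, forall v, v \in W -> p v = v &
        forall a v, p (rho a v) = rho a (p v)].

Lemma invariantP (W : {vspace V}) :
  invariant rho W <-> forall a v, v \in W -> rho a v \in W.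
Proof.
split=> [iW a v vW|iW a]; first exact: subvP (iW a) _ (memv_img _ vW).
by apply/subvP=> _ /memv_imgP[v vW ->]; apply: iW.
Qed.

Lemma invariant_cap (U W : {vspace V}) :
  invariant rho U -> invariant rho W -> invariant rho (U :&: W)%VS.
Proof.
move=> /invariantP iU /invariantP iW; apply/invariantP=> a v.
by rewrite !memv_cap => /andP[vU vW]; rewrite iU ?iW.
Qed.

Lemma invariant_add (U W : {vspace V}) :
  invariant rho U -> invariant rho W -> invariant rho (U + W)%VS.
Proof. by move=> iU iW a; rewrite limgD addvS. Qed.

Lemma invariant_sum (I : finType) (P : pred I) (W : I -> {vspace V}) :
  (forall i, invariant rho (W i)) -> invariant rho (\sum_(i | P i) W i)%VS.
Proof.
move=> iW; elim/big_rec: _ => [a|i U _ iU]; first by rewrite limg0.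
exact: invariant_add.
Qed.

Lemma invariant_lker (p : 'End(V)) :
  (forall a v, p (rho a v) = rho a (p v)) -> invariant rho (lker p).
Proof.
move=> pC; apply/invariantP=> a v; rewrite !memv_ker pC => /eqP->.
by rewrite linear0.
Qed.

(** A maximal subfamily of the simple summands whose sum [C] meets [W] trivially makes [C] an
    invariant complement of [W]; the retraction is the projection along [C]. *)
Lemma completely_reducible_splits : completely_reducible rho -> splits.
Proof.
move=> [n [S [Sirr _ Sfull]]] W iW.
have iS i : invariant rho (S i) by have [] := Sirr i.
pose Q (J : {set 'I_n}) := (W :&: \sum_(i in J) S i == 0)%VS.
have Q0 : Q set0 by rewrite /Q big_set0 capv0.
case: (@arg_maxnP _ set0 Q (fun J => #|J|) Q0) => J /eqP QJ Jmax.
set C := (\sum_(i in J) S i)%VS in QJ.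
have iC : invariant rho C by apply: invariant_sum.
have WC : (W + C)%VS = fullv.
  apply/eqP; rewrite eqEsubv subvf -Sfull; apply/subv_sumP=> i _.
  have [_ _ /(_ (S i :&: (W + C))%VS)] := Sirr i.
  case; [exact/invariant_cap/invariant_add | exact: capvSl | | ]; last first.
    by move=> <-; apply: capvSr.
  move=> Si0; have [iJ|iJ] := boolP (i \in J).
    exact: subv_trans (sumv_sup i iJ (subvv _)) (addvSr _ _).
  (* If [S i] meets [W + C] trivially, then adding [i] to [J] keeps the sum disjoint from [W],
     against maximality. *)
  have/Jmax : Q (i |: J).
    rewrite /Q -subv0 big_setU1 //=; apply/subvP=> w.
    rewrite memv_cap => /andP[wW /memv_addP[x xS [s sC wE]]].
    have x0 : x \in (S i :&: (W + C))%VS.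
      rewrite memv_cap xS (_ : x = w - s); last by rewrite wE addrK.
      by rewrite memvB // (subvP (addvSl _ _) _ wW, subvP (addvSr _ _) _ sC).
    move: x0; rewrite Si0 memv0 => /eqP x0.
    by rewrite -QJ memv_cap wW wE x0 add0r.
  by rewrite /= cardsU1 iJ add1n ltnn.
have pW := memv_pi W C; have qC := memv_pi C W.
have pqE v : daddv_pi W C v + daddv_pi C W v = v.
  by apply: daddv_pi_add QJ _; rewrite WC memvf.
exists (daddv_pi W C); split=> [v|v vW|a v]; [exact: pW|exact: daddv_pi_id|].
have iWP := (invariantP W).1 iW; have iCP := (invariantP C).1 iC.
(* [C] is invariant, so the image of the [C]-part of [v] stays in [C] and has no [W]-part. *)
have qC0 : daddv_pi W C (rho a (daddv_pi C W v)) = 0.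
  apply: (addIr (rho a (daddv_pi C W v))); rewrite add0r.
  by rewrite -{2}(@daddv_pi_id _ _ C W (rho a _)) ?pqE // 1?capvC // iCP.
rewrite -{1}(pqE v) linearD /= linearD /= qC0 addr0.
by rewrite (daddv_pi_id QJ (iWP a _ (pW v))).
Qed.

(** By induction on dimension: if [U] is not irreducible, classical logic yields a proper nonzero
    invariant subspace. *)
Lemma irreducible_subspace (U : {vspace V}) :
  invariant rho U -> U != 0%VS -> exists2 S, irreducible rho S & (S <= U)%VS.
Proof.
have [m] := ubnP (\dim U); elim: m U => // m IH U /ltnSE leUm iU U0.
have [irrU|] := boolp.pselect (irreducible rho U); first by exists U.
move=> nirr; suff [W [iW sWU W0 WU]] : exists W,
    [/\ invariant rho W, (W <= U)%VS, W != 0%VS & W != U].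
  have [|S irrS sSW] := IH W _ iW W0; last by exists S => //; apply: subv_trans sWU.
  rewrite (leq_trans _ leUm) // ltn_neqAle dimvS // andbT.
  by apply: contraNneq WU => eqd; rewrite eqEdim sWU eqd leqnn.
apply: boolp.contrapT => nW; apply: nirr; split=> // W iW sWU.
have [->|W0] := eqVneq W 0%VS; first by left.
by have [->|WU] := eqVneq W U; [right | case: nW; exists W].
Qed.

(** An invariant [U] is the direct sum of an irreducible [S] and the part of [U] killed by the
    retraction onto [S]; the latter has smaller dimension. *)
Lemma splits_completely_reducible : splits -> completely_reducible rho.
Proof.
move=> spl; suff: forall U, invariant rho U -> exists n (W : 'I_n -> {vspace V}),
    [/\ forall i, irreducible rho (W i), directv (\sum_i W i)%VS &
        (\sum_i W i)%VS = U].
  by apply=> a; apply: subvf.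
move=> U; have [m] := ubnP (\dim U); elim: m U => // m IH U /ltnSE leUm iU.
have [->|U0] := eqVneq U 0%VS.
  exists 0%N, (fun=> 0%VS); split=> [[]||] //; last by rewrite big_ord0.
  by rewrite directvE /= !big_ord0 dimv0.
have [S Sirr sSU] := irreducible_subspace iU U0.
have [iS S0 _] := Sirr; have [p [pS pid pC]] := spl S iS.
pose U' := (U :&: lker p)%VS.
have iU' : invariant rho U' by apply: invariant_cap => //; apply: invariant_lker.
have SU'0 : (S :&: U' = 0)%VS.
  apply/eqP; rewrite -subv0; apply/subvP=> v.
  by rewrite !memv_cap memv_ker => /and3P[vS _]; rewrite pid // memv0.
have SU' : (S + U' = U)%VS.
  apply/eqP; rewrite eqEsubv subv_add sSU capvSl /=; apply/subvP=> v vU.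
  rewrite -(subrK (p v) v) addrC memv_add //.
  rewrite memv_cap memv_ker linearB /= [p (p v)]pid ?pS // subrr eqxx andbT.
  by rewrite memvB // (subvP sSU) ?pS.
have dimU : \dim U = (\dim S + \dim U')%N by rewrite -SU' dimv_disjoint_sum.
have [|n [W [Wirr Wdir WU']]] := IH U' _ iU'.
  rewrite (leq_trans _ leUm) // dimU -[X in (X < _)%N]add0n ltn_add2r.
  by rewrite lt0n dimv_eq0.
(* [S] takes index 0 and the summands of [U'] are shifted by one; directness is then checked by
   adding dimensions. *)
exists n.+1, (fun i => oapp W S (unlift ord0 i)); split.
- by move=> i; case: unliftP => [j|] _ /=.
- move: Wdir; rewrite !directvE /= !big_ord_recl unlift_none /=.
  under [X in _ -> (\dim (_ + X)%VS == _)]eq_bigr do rewrite liftK /=.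
  under [X in _ -> (_ == (_ + X)%N)]eq_bigr do rewrite liftK /=.
  by rewrite WU' => /eqP <-; rewrite SU' dimU.
- rewrite big_ord_recl unlift_none /=.
  by under eq_bigr do rewrite liftK /=; rewrite WU'.
Qed.
End Splitting.

(** * The algebra of matrices over [A] with rows and columns indexed by [G] *)

Section MatrixAlgebra.
Variables (K : fieldType) (G : finZmodType) (A : algType K).

(* MathComp's square matrices over a noncommutative [A] carry no [K]-algebra
   structure. *)
Definition gmatrix : Type := {ffun G * G -> A}.
HB.instance Definition _ := GRing.Lmodule.on gmatrix.

Definition gmatrix_of (f : G -> G -> A) : gmatrix := [ffun kh => f kh.1 kh.2].

Definition gmatrix_coef k h (m : gmatrix) : A := m (k, h).
Fact gmatrix_coef_linear k h : linear (gmatrix_coef k h).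
Proof. by move=> a m n; rewrite /gmatrix_coef !ffunE. Qed.
HB.instance Definition _ k h :=
  GRing.isLinear.Build K gmatrix A *:%R (gmatrix_coef k h) (gmatrix_coef_linear k h).

Lemma gmatrixP (m n : gmatrix) :
  (forall k h, gmatrix_coef k h m = gmatrix_coef k h n) -> m = n.
Proof. by move=> mn; apply: (iffLR (ffunP m n)) => -[k h]; apply: mn. Qed.

Lemma gmatrix_ofE f k h : gmatrix_coef k h (gmatrix_of f) = f k h.
Proof. by rewrite /gmatrix_coef ffunE. Qed.

Definition gmatrix_mul (m n : gmatrix) : gmatrix :=
  gmatrix_of (fun k h => \sum_l gmatrix_coef k l m * gmatrix_coef l h n).
Definition gmatrix_one : gmatrix := gmatrix_of (fun k h => (k == h)%:R).

Fact gmatrix_mulA : associative gmatrix_mul.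
Proof.
move=> m n p; apply: gmatrixP => k h; rewrite !gmatrix_ofE.
under eq_bigr do rewrite gmatrix_ofE mulr_sumr.
rewrite exchange_big; apply: eq_bigr => l _ /=.
by rewrite gmatrix_ofE mulr_suml; apply: eq_bigr => l' _; rewrite mulrA.
Qed.
Fact gmatrix_mul1 : left_id gmatrix_one gmatrix_mul.
Proof.
move=> m; apply: gmatrixP => k h; rewrite gmatrix_ofE (bigD1 k) //= big1.
  by rewrite gmatrix_ofE eqxx mul1r addr0.
by move=> l /negPf lk; rewrite gmatrix_ofE eq_sym lk mul0r.
Qed.
Fact gmatrix_mulr1 : right_id gmatrix_one gmatrix_mul.
Proof.
move=> m; apply: gmatrixP => k h; rewrite gmatrix_ofE (bigD1 h) //= big1.
  by rewrite gmatrix_ofE eqxx mulr1 addr0.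
by move=> l /negPf lk; rewrite gmatrix_ofE lk mulr0.
Qed.
Fact gmatrix_mulDl : left_distributive gmatrix_mul +%R.
Proof.
move=> m n p; apply: gmatrixP => k h; rewrite raddfD /= !gmatrix_ofE -big_split.
by apply: eq_bigr => l _; rewrite raddfD mulrDl.
Qed.
Fact gmatrix_mulDr : right_distributive gmatrix_mul +%R.
Proof.
move=> m n p; apply: gmatrixP => k h; rewrite raddfD /= !gmatrix_ofE -big_split.
by apply: eq_bigr => l _; rewrite raddfD mulrDr.
Qed.
Fact gmatrix_1neq0 : gmatrix_one != 0.
Proof.
apply/eqP=> /(congr1 (gmatrix_coef 0 0)); rewrite raddf0 gmatrix_ofE eqxx.
by apply/eqP/oner_neq0.
Qed.
HB.instance Definition _ := GRing.Zmodule_isNzRing.Build gmatrix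
  gmatrix_mulA gmatrix_mul1 gmatrix_mulr1 gmatrix_mulDl gmatrix_mulDr gmatrix_1neq0.

Lemma gmatrix_coefM k h (m n : gmatrix) :
  gmatrix_coef k h (m * n) = \sum_l gmatrix_coef k l m * gmatrix_coef l h n.
Proof. exact: gmatrix_ofE. Qed.

Lemma gmatrix_coef1 k h : gmatrix_coef k h (1 : gmatrix) = (k == h)%:R.
Proof. exact: gmatrix_ofE. Qed.

Fact gmatrix_scaleAl k (m n : gmatrix) : k *: (m * n) = (k *: m) * n.
Proof.
apply: gmatrixP => g h; rewrite linearZ /= !gmatrix_coefM scaler_sumr.
by apply: eq_bigr => l _; rewrite linearZ scalerAl.
Qed.
HB.instance Definition _ := GRing.Lmodule_isLalgebra.Build K gmatrix gmatrix_scaleAl.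
Fact gmatrix_scaleAr k (m n : gmatrix) : k *: (m * n) = m * (k *: n).
Proof.
apply: gmatrixP => g h; rewrite linearZ /= !gmatrix_coefM scaler_sumr.
by apply: eq_bigr => l _; rewrite linearZ scalerAr.
Qed.
HB.instance Definition _ := GRing.Lalgebra_isAlgebra.Build K gmatrix gmatrix_scaleAr.
End MatrixAlgebra.

(** * The space V (x) KG as functions from [G] to [V] *)

Section PowerSpace.
Variables (K : fieldType) (G : finType) (V : vectType K).

Definition power_delta (h : G) (v : V) : {ffun G -> V} :=
  [ffun k => if k == h then v else 0].

Fact power_delta_linear h : linear (power_delta h).
Proof.
move=> a u v; apply/ffunP=> k; rewrite !ffunE; case: ifP => // _.
by rewrite scaler0 addr0.
Qed.
HB.instance Definition _ h :=
  GRing.isLinear.Build K V {ffun G -> V} *:%R (power_delta h) (power_delta_linear h).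

Lemma power_deltaE h v k : power_delta h v k = if k == h then v else 0.
Proof. by rewrite ffunE. Qed.

Lemma power_delta_sum (f : {ffun G -> V}) : f = \sum_h power_delta h (f h).
Proof.
apply/ffunP=> k; rewrite sum_ffunE (bigD1 k) //= power_deltaE eqxx big1 ?addr0 //.
by move=> h /negPf hk; rewrite power_deltaE eq_sym hk.
Qed.

Definition power_coef (h : G) (f : {ffun G -> V}) : V := f h.
Fact power_coef_linear h : linear (power_coef h).
Proof. by move=> a f f'; rewrite /power_coef !ffunE. Qed.
HB.instance Definition _ h :=
  GRing.isLinear.Build K {ffun G -> V} V *:%R (power_coef h) (power_coef_linear h).

(** The subspace W (x) KG. *)
Definition power_vs (W : {vspace V}) : {vspace {ffun G -> V}} :=
  (\sum_h (linfun (power_delta h) @: W))%VS.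

Lemma power_vsP (W : {vspace V}) (f : {ffun G -> V}) :
  reflect (forall h, f h \in W) (f \in power_vs W).
Proof.
apply: (iffP memv_sumP) => [[F FW -> h]|fW].
  rewrite sum_ffunE rpred_sum // => k _.
  have /memv_imgP[v vW ->] := FW k isT.
  by rewrite lfunE /= power_deltaE; case: ifP; rewrite ?mem0v.
exists (fun h => power_delta h (f h)) => [h _|]; last exact: power_delta_sum.
by rewrite -[power_delta h _](lfunE (power_delta h)) memv_img.
Qed.
End PowerSpace.

(** * Linearity and pullback of representations *)

Section RepresentationLinear.
Variables (K : fieldType) (A : algType K) (V : vectType K) (rho : A -> 'End(V)).
Hypothesis rep_rho : representation rho.

Let rhoL : linear rho. Proof. by case: rep_rho. Qed.
HB.instance Definition _ := GRing.isLinear.Build K A 'End(V) *:%R rho rhoL.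

Lemma representation0 : rho 0 = 0. Proof. exact: linear0. Qed.

Lemma representationZ k a : rho (k *: a) = k *: rho a. Proof. exact: linearZ. Qed.

Lemma representation_sum (I : Type) (r : seq I) (P : pred I) (f : I -> A) :
  rho (\sum_(i <- r | P i) f i) = \sum_(i <- r | P i) rho (f i).
Proof. exact: linear_sum. Qed.
End RepresentationLinear.

Lemma representation_comp (K : fieldType) (A B : algType K) (F : {lrmorphism B -> A})
    (V : vectType K) (rho : A -> 'End(V)) :
  representation rho -> representation (rho \o F).
Proof.
move=> [rhoL rho1 rhoM]; split=> [k a b||a b] /=; first by rewrite linearP rhoL.
- by rewrite rmorph1.
- by rewrite rmorphM.
Qed.

(** * Representations on V (x) KG induced by a morphism into matrices *)

Section MatrixRepresentation.
Variables (K : fieldType) (G : finZmodType) (A B : algType K).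
Variable F : {lrmorphism B -> gmatrix G A}.

Section Rep.
Variables (V : vectType K) (rho : A -> 'End(V)).

(** The matrix of [b], with [rho] applied to its entries, acting on column vectors. *)
Definition power_act (b : B) (f : {ffun G -> V}) : {ffun G -> V} :=
  [ffun k => \sum_h rho (gmatrix_coef k h (F b)) (f h)].
Fact power_act_linear b : linear (power_act b).
Proof.
move=> a f f'; apply/ffunP=> k; rewrite !ffunE scaler_sumr -big_split /=.
by apply: eq_bigr => h _; rewrite !ffunE linearP.
Qed.
HB.instance Definition _ b := GRing.isLinear.Build K {ffun G -> V} {ffun G -> V} *:%R
  (power_act b) (power_act_linear b).

Definition power_rep (b : B) : 'End({ffun G -> V}) := linfun (power_act b).

Lemma power_repE b f k :
  power_rep b f k = \sum_h rho (gmatrix_coef k h (F b)) (f h).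
Proof. by rewrite lfunE ffunE. Qed.

Lemma power_vs_invariant W : invariant rho W -> invariant power_rep (power_vs G W).
Proof.
move=> /invariantP iW; apply/invariantP=> b f /power_vsP fW; apply/power_vsP=> k.
by rewrite power_repE rpred_sum // => h _; apply: iW.
Qed.

Hypothesis rep_rho : representation rho.

Let rhoL : linear rho. Proof. by case: rep_rho. Qed.
HB.instance Definition _ := GRing.isLinear.Build K A 'End(V) *:%R rho rhoL.

Lemma power_rep_representation : representation power_rep.
Proof.
have [_ rho1 rhoM] := rep_rho; split=> [a b b'||b b'].
- apply/lfunP=> f; apply/ffunP=> k; rewrite add_lfunE scale_lfunE !ffunE.
  rewrite !power_repE scaler_sumr -big_split; apply: eq_bigr => h _ /=.
  by rewrite !linearP add_lfunE scale_lfunE.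
- apply/lfunP=> f; apply/ffunP=> k; rewrite power_repE rmorph1 id_lfunE.
  rewrite (bigD1 k) //= gmatrix_coef1 eqxx rho1 id_lfunE big1 ?addr0 // => h.
  by rewrite gmatrix_coef1 eq_sym => /negPf->; rewrite raddf0 zero_lfunE.
- apply/lfunP=> f; apply/ffunP=> k; rewrite comp_lfunE !power_repE.
  under [RHS]eq_bigr do rewrite power_repE linear_sum.
  rewrite exchange_big; apply: eq_bigr => h _ /=.
  rewrite rmorphM gmatrix_coefM raddf_sum sum_lfunE; apply: eq_bigr => l _ /=.
  by rewrite rhoM comp_lfunE.
Qed.

Lemma power_rep_delta b h v k :
  power_rep b (power_delta h v) k = rho (gmatrix_coef k h (F b)) v.
Proof.
rewrite power_repE (bigD1 h) //= power_deltaE eqxx big1 ?addr0 // => l /negPf lh.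
by rewrite power_deltaE lh linear0.
Qed.
End Rep.

Definition separated (C : algType K) : Prop :=
  forall c : C, (forall (V : vectType K) (rho : C -> 'End(V)),
    representation rho -> rho c = 0) -> c = 0.

(** Applied to a vector in slot [h], the induced representation exhibits the entries of column [h]
    under [rho]; if [b] acts by zero everywhere, every entry of [F b] is killed by all [rho]. *)
Lemma separated_gmatrix : injective F -> separated A -> separated B.
Proof.
move=> F_inj sepA b b0; apply: F_inj; rewrite raddf0; apply: gmatrixP => k h.
rewrite raddf0; apply: sepA => V rho rep_rho; apply/lfunP=> v.
rewrite -power_rep_delta b0 ?zero_lfunE ?ffunE //.
exact: power_rep_representation.
Qed.
End MatrixRepresentation.

Lemma FCR_splits (K : fieldType) (A : algType K) :
  FCR A <->
  (forall (V : vectType K) (rho : A -> 'End(V)), representation rho -> splits rho)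
    /\ separated A.
Proof.
split=> -[cr sep]; split=> // V rho /cr.
  exact: completely_reducible_splits.
exact: splits_completely_reducible.
Qed.

(** * The twisted group algebra K_cG with coefficients in [A], as matrices *)

Section TwistedUnits.
Variables (K : fieldType) (G : finZmodType) (c : cocycle K G) (A : algType K).

Lemma cocycle0l g : c 0 g = c 0 0.
Proof.
apply: (mulIf (cocycle_neq0 c 0 g)).
by have := cocycleP c 0 0 g; rewrite !add0r => ->.
Qed.

(* [twisted_unit g w] is left multiplication by g (x) w on K_cG (x) A, where
   K_cG is the group algebra twisted by c, as a matrix over the basis G. *)
Definition twisted_unit (g : G) (w : A) : gmatrix G A :=
  gmatrix_of (fun k h => if k == g + h then c g h *: w else 0).

Fact twisted_unit_linear g : linear (twisted_unit g).
Proof.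
move=> a u v; apply: gmatrixP => k h; rewrite linearP /= !gmatrix_ofE.
by case: ifP => _; rewrite ?scaler0 ?addr0 // scalerDr !scalerA mulrC.
Qed.
HB.instance Definition _ g :=
  GRing.isLinear.Build K A (gmatrix G A) *:%R (twisted_unit g) (twisted_unit_linear g).

Lemma twisted_unitM g h u v :
  twisted_unit g u * twisted_unit h v = c g h *: twisted_unit (g + h) (u * v).
Proof.
apply: gmatrixP => k l; rewrite gmatrix_coefM linearZ /= (bigD1 (h + l)) //= big1.
  rewrite !gmatrix_ofE eqxx addr0 addrA; case: ifP => _; last by rewrite mul0r scaler0.
  by rewrite mulZZ scalerA cocycleP mulrC.
by move=> m /negPf mhl; rewrite !gmatrix_ofE mhl mulr0.
Qed.

(** The unit of K_cG is c(0,0)^-1 times the basis vector at 0, because c(0,g) = c(0,0). *)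
Lemma twisted_unit1 : twisted_unit 0 ((c 0 0)^-1 *: 1) = 1.
Proof.
apply: gmatrixP => k h; rewrite gmatrix_ofE gmatrix_coef1 add0r cocycle0l.
by case: ifP => // _; rewrite scalerA mulfV ?scale1r ?cocycle_neq0.
Qed.

Lemma twisted_unit_coef g w k h :
  gmatrix_coef k h (twisted_unit g w) = if k == g + h then c g h *: w else 0.
Proof. exact: gmatrix_ofE. Qed.
End TwistedUnits.

Section CocycleInverse.
Variables (K : fieldType) (G : finZmodType) (c : cocycle K G).

Fact cocycle_inv_neq0 g h : (c g h)^-1 != 0.
Proof. by rewrite invr_neq0 ?cocycle_neq0. Qed.
Fact cocycle_invP g h k :
  (c g h)^-1 * (c (g + h) k)^-1 = (c h k)^-1 * (c g (h + k))^-1.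
Proof. by rewrite -!invfM cocycleP. Qed.
Definition cocycle_inv : cocycle K G := Cocycle cocycle_inv_neq0 cocycle_invP.
End CocycleInverse.

(** * Presentations of U(L) and U(L^c) by G-homogeneous relations *)

Section Presentation.
Variables (K : fieldType) (G : finZmodType) (eps : bicharacter K G).
Variable L : colorLie eps.

Definition color_rel (b d : G -> G -> K) (B : algType K) (f : L -> B) : Prop :=
  forall g h x y, x \in cl_comp L g -> y \in cl_comp L h ->
    f x * f y = b g h *: (f y * f x) + d g h *: f (cl_br L x y).

(* A common presentation for U(L), where d = 1, and U(L^c), where d = c, which
   does not mention G'; it makes the two algebras play symmetric roles. *)
Record presented (b d : G -> G -> K) (A : algType K) (i : {linear L -> A}) : Prop := {
  presented_rel : color_rel b d i;
  presented_lift : forall (B : algType K) (f : {linear L -> B}), color_rel b d f ->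
    exists F : {lrmorphism A -> B}, forall x, F (i x) = f x;
  presented_ind : forall P : A -> Prop,
    P 1 -> (forall x u, P u -> P (i x * u)) ->
    (forall k u v, P u -> P v -> P (k *: u + v)) -> forall u, P u }.

Lemma enveloping_presented :
  @presented eps (fun _ _ => 1) (enveloping L) (env_in L).
Proof.
split=> [g h x y xg yh|B f fP|].
- by rewrite scale1r; apply: env_inM.
- have fP' g h x y : x \in cl_comp L g -> y \in cl_comp L h ->
      f x * f y = eps g h *: (f y * f x) + f (cl_br L x y).
    by move=> xg yh; rewrite (fP _ _ _ _ xg yh) scale1r.
  exists (env_lift fP') => x; exact: env_liftE.
- exact: env_ind.
Qed.

(** A component of L^c is a sum of components of [L], so by bilinearity each relation between
    G'-homogeneous elements is a sum of relations between their G-components. *)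
Lemma cocycle_twist_presented (G' : zmodType) (c : cocycle K G)
    (phi : {additive G -> G'}) (eps' : bicharacter K G')
    (ce : twist_compatible eps c phi eps') :
  @presented (fun g h => eps' (phi g) (phi h)) c
    (enveloping (cocycle_twist L ce))
    (env_in (cocycle_twist L ce) : {linear cocycle_twist L ce -> _}).
Proof.
split=> [g h x y xg yh|B f fP|]; last exact: (@env_ind _ _ _ (cocycle_twist L ce)).
- rewrite -env_inZ -(twist_brE c xg yh).
  apply: (env_inM (L := cocycle_twist L ce)).
    exact: subvP (twist_comp_sub L (erefl _)) _ xg.
  exact: subvP (twist_comp_sub L (erefl _)) _ yh.
- pose f' : {linear cocycle_twist L ce -> B} := f.
  have fP' g' h' (x y : cocycle_twist L ce) :
      x \in cl_comp (cocycle_twist L ce) g' -> y \in cl_comp (cocycle_twist L ce) h' ->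
      f' x * f' y = eps' g' h' *: (f' y * f' x) + f' (cl_br (cocycle_twist L ce) x y).
    move=> xg' yh'; rewrite /f' /=.
    rewrite -{1 2}(cl_proj_sum (L := L) x) -{1 2}(cl_proj_sum (L := L) y) /twist_br !linear_sum /=.
    rewrite !mulr_suml scaler_sumr.
    rewrite [X in _ = _ + X](eq_bigr _ (fun g _ => linear_sum f _ _ _)).
    under [X in _ = X + _]eq_bigr do rewrite mulr_sumr scaler_sumr.
    rewrite [X in _ = X + _]exchange_big -big_split; apply: eq_bigr => g _ /=.
    rewrite mulr_sumr -big_split; apply: eq_bigr => h _ /=.
    have [gg'|/eqP gg'] := phi g =P g'; last first.
      rewrite (twist_comp_proj0 xg' gg') cl_br0l !linear0.
      by rewrite mul0r mulr0 scaler0 addr0.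
    have [hh'|/eqP hh'] := phi h =P h'; last first.
      rewrite (twist_comp_proj0 yh' hh') cl_br0r !linear0.
      by rewrite mul0r mulr0 scaler0 addr0.
    rewrite (fP _ _ _ _ (cl_proj_comp g x) (cl_proj_comp h y)) gg' hh'.
    by rewrite [f (_ *: _)]linearZ.
  exists (env_lift fP') => x; exact: (env_liftE fP').
Qed.

(** * Embedding one presented algebra in a twisted group algebra over the other *)

Section Comparison.
Variables (c : cocycle K G) (b d b' d' : G -> G -> K).
Variables (A A' : algType K) (i : {linear L -> A}) (i' : {linear L -> A'}).
Hypotheses (pA : presented b d i) (pA' : presented b' d' i').

(** Compatibility of the triple, together with the scaling of the bracket, written so that inverting
    the cocycle swaps the two sides. *)
Definition twist_related (e : cocycle K G) (p q p' q' : G -> G -> K) : Prop :=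
  forall g h, p g h * e g h = e h g * p' g h /\ q' g h = e g h * q g h.

Lemma twist_related_inv e p q p' q' :
  twist_related e p q p' q' -> twist_related (cocycle_inv e) p' q' p q.
Proof.
move=> r g h; have [e1 e2] := r g h; have n0 := cocycle_neq0 e.
split=> /=; last by rewrite e2 mulKf.
apply: (mulIf (n0 g h)); rewrite mulfVK // -mulrA e1 mulKf //.
Qed.

(** Exchanging g (x) x and h (x) y costs b(g,h) in [A] and c(g,h)/c(h,g) in K_cG, together b'(g,h);
    the factor c(g,h) in front of the bracket turns [d] into [d']. So the relations of [A'] hold. *)
Lemma twisted_embedding : twist_related c b d b' d' ->
  exists F : {lrmorphism A' -> gmatrix G A},
    forall g x, x \in cl_comp L g -> F (i' x) = twisted_unit c g (i x).
Proof.
move=> r; pose f x := \sum_g twisted_unit c g (i (cl_proj L g x)).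
have f_lin : linear f.
  move=> a x y; rewrite /f scaler_sumr -big_split; apply: eq_bigr => g _ /=.
  by rewrite !linearP.
pose flin := GRing.isLinear.Build K L (gmatrix G A) *:%R f f_lin.
pose fl : {linear L -> gmatrix G A} := HB.pack f flin.
have fE g x : x \in cl_comp L g -> f x = twisted_unit c g (i x).
  move=> xg; rewrite /f (bigD1 g) //= (cl_projE _ xg) eqxx big1 ?addr0 // => h /negPf hg.
  by rewrite (cl_projE _ xg) hg !linear0.
have [|F FE] := presented_lift pA' (f := fl); last first.
  by exists F => g x xg; rewrite FE; apply: fE.
move=> g h x y xg yh; rewrite /= (fE _ _ xg) (fE _ _ yh) (fE _ _ (cl_br_comp xg yh)).
have [r1 r2] := r g h; rewrite !twisted_unitM (presented_rel pA xg yh).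
rewrite linearD /= !linearZ /= scalerDr !scalerA r2 [h + g]addrC.
by rewrite -r1 [b _ _ * _]mulrC.
Qed.
End Comparison.

(** * Transfer of the FCR property between the two presented algebras *)

Section Transfer.
Variables (c : cocycle K G) (b d b' d' : G -> G -> K).
Variables (A A' : algType K) (i : {linear L -> A}) (i' : {linear L -> A'}).
Hypotheses (pA : presented b d i) (pA' : presented b' d' i').
Variables (F : {lrmorphism A' -> gmatrix G A}) (F' : {lrmorphism A -> gmatrix G A'}).
Hypothesis FE : forall g x, x \in cl_comp L g -> F (i' x) = twisted_unit c g (i x).
Hypothesis F'E : forall g x, x \in cl_comp L g ->
  F' (i x) = twisted_unit (cocycle_inv c) g (i' x).

(* u in A' and w in A are the same element of degree g. *)
Definition partners g (u : A') (w : A) : Prop :=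
  F u = twisted_unit c g w /\ F' w = twisted_unit (cocycle_inv c) g u.

(** This serves as a grading of [A'] matched with [A]. By induction on words, the partner of a
    product of degrees g and h is c(g,h) times the product of the partners. *)
Lemma partners_sum u : exists f : G -> A', exists f' : G -> A,
  (forall g, partners g (f g) (f' g)) /\ u = \sum_g f g.
Proof.
have n0 := cocycle_neq0 c.
have p0 g : partners g 0 0 by split; rewrite !linear0.
have pP g k u1 w1 u2 w2 : partners g u1 w1 -> partners g u2 w2 ->
    partners g (k *: u1 + u2) (k *: w1 + w2).
  by move=> [e1 e1'] [e2 e2']; split; rewrite !linearP /= ?(e1, e1') ?(e2, e2').
elim/(presented_ind pA'): u => [|x u [f [f' [fP ->]]]|k u v].
- exists (fun g => if g == 0 then 1 else 0).
  (* The scalar is the one for which [twisted_unit] at 0 is the identity matrix. *)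
  exists (fun g => if g == 0 then (c 0 0)^-1 *: 1 else 0); split.
    move=> g; case: eqP => [->|_] //; split; first by rewrite rmorph1 twisted_unit1.
    rewrite linearZ rmorph1 -(twisted_unit1 (cocycle_inv c)) /= -linearZ /= invrK.
    by rewrite scalerA mulVf ?scale1r.
  by rewrite -big_mkcond big_pred1_eq.
- exists (fun k => \sum_g i' (cl_proj L g x) * f (k - g)).
  exists (fun k => \sum_g c g (k - g) *: (i (cl_proj L g x) * f' (k - g))); split.
    move=> k; elim/big_rec2: _ => [|g u' w' _ uw']; first exact: p0.
    rewrite -[_ * f _]scale1r -[_ *: (_ * f' _)]scale1r; apply: pP => //.
    have [e e'] := fP (k - g); have xg := cl_proj_comp g x.
    split; first by rewrite rmorphM /= (FE xg) e twisted_unitM -linearZ [g + _]addrC subrK.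
    rewrite linearZ rmorphM /= (F'E xg) e' twisted_unitM scalerA mulfV // scale1r.
    by rewrite [g + _]addrC subrK.
  rewrite exchange_big /= -{1}[x]cl_proj_sum raddf_sum mulr_suml /=.
  apply: eq_bigr => g _; rewrite -mulr_sumr; congr (_ * _).
  by rewrite [LHS](reindex_inj (addIr (- g))).
- move=> [f1 [f1' [p1 ->]]] [f2 [f2' [p2 ->]]].
  exists (fun g => k *: f1 g + f2 g), (fun g => k *: f1' g + f2' g).
  by split=> [g|]; [apply: pP | rewrite big_split /= scaler_sumr].
Qed.

(** In column 0 the images of the components of [u] occupy distinct rows, so [F u = 0] kills each
    partner in [A]; applying [F'] to the partner then kills the component itself. *)
Lemma embedding_inj : injective F.
Proof.
apply: raddf_inj => u; have [f [f' [fP ->]]] := partners_sum u.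
rewrite raddf_sum => F0; apply: big1 => g _; have [_ e'] := fP g.
suff f'0 : f' g = 0.
  have := congr1 (gmatrix_coef g 0) e'; rewrite f'0 !raddf0 twisted_unit_coef addr0 eqxx.
  by move/esym/eqP; rewrite scaler_eq0 (negPf (cocycle_neq0 _ _ _)) => /eqP.
have := congr1 (gmatrix_coef g 0) F0; rewrite raddf0 raddf_sum (bigD1 g) //= big1.
  have [-> _] := fP g; rewrite addr0 twisted_unit_coef addr0 eqxx.
  by move/eqP; rewrite scaler_eq0 (negPf (cocycle_neq0 _ _ _)) => /eqP.
by move=> h /negPf hg; have [-> _] := fP h; rewrite twisted_unit_coef addr0 eq_sym hg.
Qed.

(** Separation follows from the embedding [F]; retractions come from averaging over V (x) KG, on
    which [A] acts through [F']. *)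
Lemma FCR_transfer : [pchar K] =i pred0 -> FCR A -> FCR A'.
Proof.
move=> charK /FCR_splits[splA sepA]; apply/FCR_splits; split; last first.
  exact: separated_gmatrix embedding_inj sepA.
move=> V rho rep_rho W iW.
have rho0 := representation0 rep_rho; have rhoZ := representationZ rep_rho.
have [p [pW pid pC]] :=
  splA _ _ (power_rep_representation F' rep_rho) _ (power_vs_invariant F' iW).
(* The sum of the diagonal blocks of [p]. Each block is the identity on [W], whence the later
   division by [#|G|], invertible in characteristic zero. *)
pose q v := \sum_h p (power_delta h v) h.
have q_lin : linear q.
  move=> a u v; rewrite /q scaler_sumr -big_split; apply: eq_bigr => h _ /=.
  by rewrite !linearP !ffunE.
pose qlin := GRing.isLinear.Build K V V *:%R q q_lin.
pose ql : {linear V -> V} := HB.pack q qlin.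
have cardG : #|G|%:R != 0 :> K.
  by rewrite (pcharf0P K).1 // -lt0n; apply/card_gt0P; exists 0.
have n0 := cocycle_neq0 c.
exists (#|G|%:R^-1 *: linfun ql); split=> [v|v vW|u v];
  rewrite !(scale_lfunE, lfunE) /= /q.
- by rewrite rpredZ // rpred_sum // => h _; apply: (power_vsP _ _ (pW _)).
- under eq_bigr => h _.
    rewrite pid ?power_deltaE ?eqxx; first over.
    by apply/power_vsP=> k; rewrite power_deltaE; case: ifP; rewrite ?mem0v.
  by rewrite sumr_const -scaler_nat scalerA mulVf ?scale1r.
rewrite linearZ; congr (_ *: _); have [f [f' [fP ->]]] := partners_sum u.
rewrite (representation_sum rep_rho) sum_lfunE.
under eq_bigr do rewrite linear_sum linear_sum sum_ffunE.
rewrite exchange_big /= sum_lfunE; apply: eq_bigr => g _.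
have [_ e'] := fP g.
(* The partner [f' g] acts by a monomial matrix moving slot [h] to slot [g + h]. *)
have actE w h : power_rep F' rho (f' g) w (g + h) = (c g h)^-1 *: rho (f g) (w h).
  rewrite power_repE e' (bigD1 h) //= big1.
    by rewrite twisted_unit_coef eqxx addr0 rhoZ scale_lfunE.
  move=> l /negPf lh; rewrite twisted_unit_coef (inj_eq (addrI g)) eq_sym lh.
  by rewrite rho0 zero_lfunE.
(* Block [g + h] is matched with block [h]: expressing the shifted vector through [f' g] costs
   c(g,h), and the action after [p] returns c(g,h)^-1. *)
rewrite (reindex_inj (addrI g)) linear_sum; apply: eq_bigr => h _ /=.
have -> : power_delta (g + h) (rho (f g) v) =
    c g h *: power_rep F' rho (f' g) (power_delta h v).
  apply/ffunP=> k; rewrite [RHS]ffunE power_rep_delta e' twisted_unit_coef power_deltaE.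
  case: ifP => _; last by rewrite rho0 zero_lfunE scaler0.
  by rewrite rhoZ scale_lfunE scalerA mulfV ?scale1r.
by rewrite linearZ ffunE /= pC actE scalerA mulfV ?scale1r.
Qed.
End Transfer.

(** Replacing [c] by its inverse exchanges [A] and [A'], so [FCR_transfer] gives both directions. *)
Lemma FCR_twist_related (c : cocycle K G) (b d b' d' : G -> G -> K)
    (A A' : algType K) (i : {linear L -> A}) (i' : {linear L -> A'}) :
  presented b d i -> presented b' d' i' -> twist_related c b d b' d' ->
  [pchar K] =i pred0 -> FCR A' <-> FCR A.
Proof.
move=> pA pA' r charK; have r' := twist_related_inv r.
have [F FE] := twisted_embedding pA pA' r.
have [F' F'E] := twisted_embedding pA' pA r'.
(* The double inverse of [c] has the same values as [c], which is all that the matrix entries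
   see. *)
have F''E g x : x \in cl_comp L g ->
    F (i' x) = twisted_unit (cocycle_inv (cocycle_inv c)) g (i x).
  move=> xg; rewrite (FE _ _ xg); apply: gmatrixP => k h.
  by rewrite !twisted_unit_coef /= invrK.
split; [exact (FCR_transfer pA F'E F''E charK)|exact (FCR_transfer pA' FE F'E charK)].
Qed.
End Presentation.

(** * The augmented algebra as a skew group algebra over U(L) *)

Section Augmented.
Variables (K : fieldType) (G : finZmodType) (eps : bicharacter K G).
Variable L : colorLie eps.

Definition aug_in : enveloping L -> augmented L := aug_tens 0.
HB.instance Definition _ := GRing.Linear.on aug_in.
Fact aug_in_monoid : monoid_morphism aug_in.
Proof.
split=> // u v; rewrite /aug_in -[RHS]/(aug_mul _ _) aug_tens_mul addr0.
by rewrite env_act0.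
Qed.
HB.instance Definition _ := GRing.isMonoidMorphism.Build (enveloping L) (augmented L)
  aug_in aug_in_monoid.

Definition aug_group (g : G) : augmented L := aug_tens g 1.

Lemma aug_groupD g h : aug_group g * aug_group h = aug_group (g + h).
Proof. by rewrite -[LHS]/(aug_mul _ _) aug_tens_mul rmorph1 mulr1. Qed.

Lemma aug_group_in g u : aug_group g * aug_in u = aug_tens g u.
Proof. by rewrite -[LHS]/(aug_mul _ _) aug_tens_mul rmorph1 mul1r addr0. Qed.

Lemma aug_in_group g u : aug_in u * aug_group g = aug_tens g (env_act g u).
Proof. by rewrite -[LHS]/(aug_mul _ _) aug_tens_mul mulr1 add0r. Qed.

(** Left multiplication by [a] on the augmented algebra, viewed as a free right U(L)-module with
    basis [G]. *)
Definition aug_matrix (a : augmented L) : gmatrix G (enveloping L) :=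
  gmatrix_of (fun k h => env_act h (a (k - h))).

Lemma aug_matrixE a k h : gmatrix_coef k h (aug_matrix a) = env_act h (a (k - h)).
Proof. exact: gmatrix_ofE. Qed.

Fact aug_matrix_linear : linear aug_matrix.
Proof.
move=> k a b; apply: gmatrixP => g h; rewrite linearP /= !aug_matrixE !ffunE.
exact: linearP.
Qed.
HB.instance Definition _ := GRing.isLinear.Build K (augmented L) _ *:%R
  aug_matrix aug_matrix_linear.
Fact aug_matrix_monoid : monoid_morphism aug_matrix.
Proof.
split=> [|a b]; apply: gmatrixP => k h; rewrite aug_matrixE.
  rewrite gmatrix_coef1 ffunE subr_eq0.
  by case: ifP => _; [apply: rmorph1 | apply: raddf0].
rewrite gmatrix_coefM ffunE raddf_sum /= [RHS](reindex_inj (addIr h)) /=.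
apply: eq_bigr => l _; rewrite !aug_matrixE rmorphM /= addrK -env_actD.
by rewrite opprD addrA addrAC addrC [h + l]addrC.
Qed.
HB.instance Definition _ := GRing.isMonoidMorphism.Build (augmented L) _
  aug_matrix aug_matrix_monoid.

Lemma aug_matrix_inj : injective aug_matrix.
Proof.
move=> a b ab; apply: augP => k; rewrite -[a k]env_act0 -[b k]env_act0.
by have := congr1 (gmatrix_coef k 0) ab; rewrite !aug_matrixE subr0.
Qed.

(** [aug_in u] acts on V (x) KG by a diagonal matrix with entry [u] in slot 0, so the block of a
    retraction at slot 0 is U(L)-equivariant. *)
Lemma enveloping_FCR : FCR (augmented L) -> FCR (enveloping L).
Proof.
move=> /FCR_splits[spl sep]; apply/FCR_splits; split=> [V rho rep_rho W iW|u u0].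
  have [p [pW pid pC]] :=
    spl _ _ (power_rep_representation aug_matrix rep_rho) _ (power_vs_invariant aug_matrix iW).
  pose q := (linfun (power_coef 0) \o p \o linfun (power_delta 0))%VF : 'End(V).
  have qE v : q v = p (power_delta 0 v) 0 by rewrite !comp_lfunE !lfunE.
  exists q; split=> [v|v vW|u v]; rewrite !qE.
  - exact: (power_vsP _ _ (pW _)).
  - rewrite pid ?power_deltaE ?eqxx //; apply/power_vsP=> k.
    by rewrite power_deltaE; case: ifP; rewrite ?mem0v.
  have rho0 := representation0 rep_rho.
  have -> : power_delta 0 (rho u v) = power_rep aug_matrix rho (aug_in u) (power_delta 0 v).
    apply/ffunP=> k; rewrite power_rep_delta power_deltaE /= aug_matrixE subr0 env_act0.
    by rewrite ffunE; case: ifP => // _; rewrite rho0 zero_lfunE.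
  rewrite pC power_repE (bigD1 0) //= aug_matrixE subr0 env_act0 ffunE eqxx.
  rewrite big1 ?addr0 // => h h0; rewrite aug_matrixE ffunE sub0r oppr_eq0 (negPf h0).
  by rewrite raddf0 rho0 zero_lfunE.
(* Every representation of the augmented algebra restricts along [aug_in] to one of U(L), where [u]
   acts by zero. *)
have : aug_in u = 0.
  by apply: sep => V rho /(representation_comp aug_in)/u0.
by move/(congr1 (fun a : augmented L => a 0)); rewrite !ffunE eqxx.
Qed.

(** Maschke: a U(L)-equivariant retraction is averaged over its conjugates by [G]. Separation uses
    the faithful matrices [aug_matrix]. *)
Lemma augmented_FCR : [pchar K] =i pred0 -> FCR (enveloping L) -> FCR (augmented L).
Proof.
move=> charK /FCR_splits[spl sep]; apply/FCR_splits; split; last first.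
  exact: separated_gmatrix aug_matrix_inj sep.
move=> V rho rep_rho W iW; have [rhoL rho1 rhoM] := rep_rho.
have iWP := (invariantP _ _).1 iW.
have rep_in := representation_comp aug_in rep_rho.
have [|p [pW pid pC]] := spl _ _ rep_in W; first by move=> a; apply: iW.
pose q : 'End(V) :=
  (\sum_g (rho (aug_group g) \o p \o rho (aug_group (- g)))%VF).
have qE v : q v = \sum_g rho (aug_group g) (p (rho (aug_group (- g)) v)).
  by rewrite sum_lfunE; apply: eq_bigr => g _; rewrite !comp_lfunE.
clearbody q.
have cardG : #|G|%:R != 0 :> K.
  by rewrite (pcharf0P K).1 // -lt0n; apply/card_gt0P; exists 0.
have qg h v : q (rho (aug_group h) v) = rho (aug_group h) (q v).
  rewrite !qE linear_sum [LHS](reindex_inj (addrI h)); apply: eq_bigr => g _ /=.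
  have e : aug_group (- (h + g)) * aug_group h = aug_group (- g).
    by rewrite aug_groupD opprD addrAC addNr add0r.
  rewrite -[rho (aug_group (- (h + g))) _]comp_lfunE -rhoM e.
  by rewrite -aug_groupD rhoM comp_lfunE.
(* Conjugation by [g] replaces [u] by [env_act g u], again in U(L), with which [p] commutes. *)
have qu u v : q (rho (aug_in u) v) = rho (aug_in u) (q v).
  rewrite !qE linear_sum; apply: eq_bigr => g _ /=.
  have e : aug_group (- g) * aug_in u = aug_in (env_act g u) * aug_group (- g).
    by rewrite aug_group_in aug_in_group -env_actD addNr env_act0.
  have e' : aug_group g * aug_in (env_act g u) = aug_in u * aug_group g.
    by rewrite aug_group_in aug_in_group.
  rewrite -[rho (aug_group (- g)) _]comp_lfunE -rhoM e rhoM comp_lfunE.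
  have /= -> := pC (env_act g u).
  by rewrite -[LHS]comp_lfunE -rhoM e' rhoM comp_lfunE.
exists (#|G|%:R^-1 *: q); split=> [v|v vW|a v]; rewrite !scale_lfunE.
- by rewrite rpredZ // qE rpred_sum // => g _; apply/iWP/pW.
- rewrite qE (eq_bigr (fun=> v)).
    by rewrite sumr_const -scaler_nat scalerA mulVf ?scale1r.
  move=> g _; rewrite pid ?iWP // -comp_lfunE -rhoM aug_groupD subrr.
  by rewrite rho1 id_lfunE.
rewrite linearZ /=; congr (_ *: _).
(* Products of group elements with elements of U(L) span the algebra, so [qg] and [qu] suffice. *)
rewrite (aug_tens_sum a) (representation_sum rep_rho) !sum_lfunE linear_sum.
apply: eq_bigr => g _ /=.
by rewrite -aug_group_in rhoM !comp_lfunE qg qu.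
Qed.
End Augmented.

Theorem theorem1p1 (K : fieldType) (charK : [pchar K] =i pred0)
    (G : finZmodType) (eps : bicharacter K G) (L : colorLie eps) :
  (forall (G' : zmodType) (c : cocycle K G) (phi : {additive G -> G'})
      (eps' : bicharacter K G') (ce : twist_compatible eps c phi eps'),
     FCR (enveloping (cocycle_twist L ce)) <-> FCR (enveloping L)) /\
  (FCR (enveloping L) <-> FCR (augmented L)).
Proof.
split=> [G' c phi eps' ce|].
  have pL := enveloping_presented L; have pLc := cocycle_twist_presented L ce.
  apply: (FCR_twist_related (c := c) pL pLc) charK.
  by move=> g h; rewrite mulr1.
split; [exact: augmented_FCR | exact: enveloping_FCR].
Qed.
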